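(* Let $G$ be a discrete quantum group with a proper length function $l$. Then the triple $(\mathbb{C}[G],l^2(G),D)$, where $\mathbb{C}[G]$ acts on $l^2(G)$ by the regular representation and $D$ is the operator determined by $D\hat\Lambda(u^\alpha_{ij})=l(\alpha)\hat\Lambda(u^\alpha_{ij})$, is a regular spectral triple.
   Context: Discrete quantum groups. A discrete quantum group $G$ is given by its reduced group $C^*$-algebra $C^*_{\mathsf r}(G)$ (the reduced unital Hopf $C^*$-algebra of the dual compact quantum group) with Haar state $\hat\phi$. $\mathrm{Irr}(G)$ is the set of equivalence classes of irreducible finite dimensional unitary corepresentations of $G$; $\epsilon$ is the trivial one, $\bar\alpha$ the conjugate of $\alpha$. $\mathbb{C}[G]\subset C^*_{\mathsf r}(G)$ is the dense Hopf $*$-algebra of matrix coefficients; $l^2(G)$ is the GNS space of $\hat\phi$, with GNS map $\hat\Lambda$, on which $C^*_{\mathsf r}(G)$ acts by the regular (GNS) representation. For $\alpha\in\mathrm{Irr}(G)$, $u^\alpha_{ij}$ ($1\le i,j\le\dim(\alpha)$) are the matrix coefficients with respect to an orthonormal basis in which the modular matrix $F^\alpha$ is diagonal, so that the vectors $\hat\Lambda(u^\alpha_{ij})$ form an orthogonal basis of $l^2(G)$. A length function is $l:\mathrm{Irr}(G)\to[0,\infty)$ with $l(\epsilon)=0$, $l(\bar\alpha)=l(\alpha)$, and $l(\alpha)\le l(\beta)+l(\gamma)$ whenever $\alpha\subset\beta\otimes\gamma$. It is proper if for every $n\in\mathbb{N}$ only finitely many $\alpha$ satisfy $l(\alpha)\le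 n$, and $l(\alpha)=0$ iff $\alpha=\epsilon$. The operator $D$ has domain $\{\sum_{\alpha,i,j}a^\alpha_{ij}\hat\Lambda(u^\alpha_{ij}):\sum_{\alpha,i,j}l(\alpha)^2|a^\alpha_{ij}|^2\|\hat\Lambda(u^\alpha_{ij})\|^2<\infty\}$ (a subset of $l^2(G)$) and $D(\sum a^\alpha_{ij}\hat\Lambda(u^\alpha_{ij}))=\sum l(\alpha)a^\alpha_{ij}\hat\Lambda(u^\alpha_{ij})$. A spectral triple $(\mathcal{A},\mathcal{H},D)$ consists of a $*$-algebra $\mathcal{A}$ faithfully represented on a Hilbert space $\mathcal{H}$ and an unbounded self-adjoint operator $D$ in $\mathcal{H}$ such that $[D,a]$ is bounded for all $a\in\mathcal{A}$ and $(1+D^2)^{-1}$ is compact (no grading is used). It is regular if for each $a\in\mathcal{A}$ both $a$ and $[D,a]$ lie in the domain of all powers of the derivation $\delta(T)=[|D|,T]$. *)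

(* Defs.v *)
From HB Require Import structures.
From mathcomp Require Import all_boot all_order all_algebra.
From mathcomp Require Import finmap complex mxtens.
From mathcomp Require Import all_classical all_reals all_analysis.
From mathcomp.analysis.showcase Require Import summability.

Set Implicit Arguments.
Unset Strict Implicit.
Unset Printing Implicit Defensive.

Import Order.TTheory GRing.Theory Num.Theory numFieldNormedType.Exports.

Local Open Scope classical_set_scope.
Local Open Scope ring_scope.
Local Open Scope complex_scope.

HB.mixin Record isStarAlgebra (C : numClosedFieldType) A
    of GRing.Algebra C A := {
  adj : A -> A;
  adjK : involutive adj;
  adjD : {morph adj : x y / x + y};
  adjZ : forall (c : C) (x : A), adj (c *: x) = Num.conj c *: adj x;
  adjM : forall x y : A, adj (x * y) = adj y * adj x }.

#[short(type="starAlgType")]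
HB.structure Definition StarAlgebra (C : numClosedFieldType) :=
  {A of isStarAlgebra C A & GRing.Algebra C A}.

(* Unital C*-algebras.  MathComp-Analysis has no join of its normed modules
   with rings, so the norm is a separate real-valued operation. *)
HB.mixin Record isCStarAlgebra (R : realType) A of StarAlgebra R[i] A := {
  cnorm : A -> R;
  cnorm_eq0 : forall x : A, cnorm x = 0 -> x = 0;
  cnormZ : forall (c : R[i]) (x : A), (cnorm (c *: x))%:C = `|c| * (cnorm x)%:C;
  cnormD : forall x y : A, cnorm (x + y) <= cnorm x + cnorm y;
  cnormM : forall x y : A, cnorm (x * y) <= cnorm x * cnorm y;
  cnorm_cstar : forall x : A, cnorm (adj x * x) = cnorm x ^+ 2;
  cnorm_complete : forall s : nat -> A,
    (forall e : R, 0 < e -> exists N : nat, forall m n : nat,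
       (N <= m)%N -> (N <= n)%N -> cnorm (s m - s n) < e) ->
    exists x : A, forall e : R, 0 < e -> exists N : nat, forall n : nat,
       (N <= n)%N -> cnorm (s n - x) < e }.

#[short(type="cstarType")]
HB.structure Definition CStarAlgebra (R : realType) :=
  {A of isCStarAlgebra R A & StarAlgebra R[i] A}.

(* Inner products are linear in the first variable. *)
HB.mixin Record isHilbert (C : numClosedFieldType) H
    of CompleteNormedModule C H := {
  dot : {dot H for Num.conj};
  dot_norm : forall x : H, dot x x = `|x| ^+ 2 }.

#[short(type="hilbertType")]
HB.structure Definition Hilbert (C : numClosedFieldType) :=
  {H of isHilbert C H & CompleteNormedModule C H}.

(* An unbounded operator D is given by its graph: D x y means that x is in the
   domain of D and D x = y. *)
Section UnboundedOperators.
Context {C : numClosedFieldType} {H : hilbertType C}.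
Implicit Types (T S K : H -> H) (D B : H -> H -> Prop).

Definition bounded_op T :=
  linear T /\ exists M : C, forall x, `|T x| <= M * `|x|.

Definition compact_op K :=
  linear K /\ precompact (K @` [set x : H | `|x| <= 1]).

Definition op_dom D : set H := [set x | exists y, D x y].

Definition op_comp D B x z := exists2 y, B x y & D y z.

Definition op_adjoint D x y := forall v w, D v w -> dot w x = dot v y.

Definition selfadjoint D :=
  dense (op_dom D) /\ forall x y, D x y <-> op_adjoint D x y.

Definition op_abs D B :=
  [/\ selfadjoint B,
      forall x y, B x y -> 0 <= dot y x
    & forall x z, op_comp B B x z <-> op_comp D D x z].

(* T preserves the domain of D, and D T - T D = S there. *)
Definition commutator D T S := forall x y, D x y -> D (T x) (S x + T y).

(* The inverse of 1 + D^2 is everywhere defined and compact: the condition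
   [op_comp D D x (z - x)] says that (1 + D^2) x = z. *)
Definition compact_resolvent D :=
  exists2 K, compact_op K &
    forall x z, op_comp D D x (z - x) <-> x = K z.

(* The domain of the n-th power of T |-> [B, T]. *)
Fixpoint derivation_dom B (n : nat) T : Prop :=
  if n is m.+1 then
    bounded_op T /\ exists2 S, commutator B T S & derivation_dom B m S
  else bounded_op T.

End UnboundedOperators.

Section SpectralTriples.
Context {C : numClosedFieldType} {A : starAlgType C} {H : hilbertType C}.

Definition star_subalgebra (S : set A) :=
  [/\ S 0,
      forall (c : C) a b, S a -> S b -> S (c *: a + b),
      forall a b, S a -> S b -> S (a * b)
    & forall a, S a -> S (adj a)].

Definition star_representation (S : set A) (pi : A -> H -> H) :=
  [/\ forall a, S a -> bounded_op (pi a),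
      forall (c : C) a b, S a -> S b ->
        forall x, pi (c *: a + b) x = c *: pi a x + pi b x,
      forall a b, S a -> S b -> forall x, pi (a * b) x = pi a (pi b x)
    & forall a, S a -> forall x y, dot (pi a x) y = dot x (pi (adj a) y)].

Definition faithful (S : set A) (pi : A -> H -> H) :=
  forall a, S a -> (forall x, pi a x = 0) -> a = 0.

Definition spectral_triple (S : set A) (pi : A -> H -> H)
    (D : H -> H -> Prop) :=
  [/\ star_subalgebra S,
      star_representation S pi /\ faithful S pi,
      selfadjoint D,
      forall a, S a -> exists2 T, bounded_op T & commutator D (pi a) T
    & compact_resolvent D].

Definition regular_spectral_triple (S : set A) (pi : A -> H -> H)
    (D : H -> H -> Prop) :=
  spectral_triple S pi D /\
  exists2 absD, op_abs D absD &
    forall a, S a ->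
      (forall n, derivation_dom absD n (pi a)) /\
      (forall T, bounded_op T -> commutator D (pi a) T ->
         forall n, derivation_dom absD n T).

End SpectralTriples.

Record hilbert_square (C : numClosedFieldType) (H : hilbertType C) := {
  hsquare :> hilbertType C;
  tens : {bilinear H -> H -> hsquare};
  tens_dot : forall x y x' y',
    dot (tens x y) (tens x' y') = dot x x' * dot y y';
  tens_dense : dense [set z : hsquare | exists n (x y : 'I_n -> H),
    z = \sum_i tens (x i) (y i)] }.

(* X lies in the norm closure of the operators sum_i pi(a_i) (x) pi(b_i).  For
   a faithful representation pi of a C*-algebra A, these X form the minimal
   tensor product of A with itself. *)
Definition min_tensor (R : realType) (A : cstarType R) (H : hilbertType R[i])
    (pi : A -> H -> H) (HH : hilbert_square H) (X : HH -> HH) :=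
  bounded_op X /\
  forall e : R, 0 < e -> exists n (a b : 'I_n -> A) (T : HH -> HH),
    [/\ bounded_op T,
        forall x y, T (tens HH x y) = \sum_i tens HH (pi (a i) x) (pi (b i) y)
      & forall z, `|X z - T z| <= e%:C * `|z|].

(* A reduced unital Hopf C*-algebra with its Haar state; [Lam] and [reg] are
   the GNS map and the GNS representation of the Haar state, whose faithfulness
   is what "reduced" means.  The comultiplication takes its values in the
   minimal tensor product, realised on l2 (x) l2 through [reg] (x) [reg]. *)
Record hopf_cstar (R : realType) := {
  Cred : cstarType R;
  haar : {scalar Cred};
  l2 : hilbertType R[i];
  Lam : {linear Cred -> l2};
  reg : Cred -> l2 -> l2;
  l2l2 : hilbert_square l2;
  Delta : Cred -> l2l2 -> l2l2;
  haar1 : haar 1 = 1;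
  haar_ge0 : forall a, 0 <= haar (adj a * a);
  Lam_dot : forall a b, dot (Lam a) (Lam b) = haar (adj b * a);
  Lam_dense : dense (range Lam);
  reg_linear : forall a, linear (reg a);
  reg_bound : forall a x, `|reg a x| <= (cnorm a)%:C * `|x|;
  reg_Lam : forall a b, reg a (Lam b) = Lam (a * b);
  reg_faithful : faithful setT reg;
  Delta_tensor : forall a, min_tensor reg (Delta a);
  Delta_hom : star_representation setT Delta;
  Delta1 : forall z, Delta 1 z = z;
  (* Coassociativity, evaluated at triples of vector functionals: b and c are
     the slices of Delta a by the functionals attached to (x3, y3) in the
     second leg and to (x1, y1) in the first leg. *)
  Delta_coassoc : forall a b c x1 y1 x2 y2 x3 y3,
    (forall x y, dot (reg b x) y =
       dot (Delta a (tens l2l2 x x3)) (tens l2l2 y y3)) ->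
    (forall x y, dot (reg c x) y =
       dot (Delta a (tens l2l2 x1 x)) (tens l2l2 y1 y)) ->
    dot (Delta b (tens l2l2 x1 x2)) (tens l2l2 y1 y2) =
    dot (Delta c (tens l2l2 x2 x3)) (tens l2l2 y2 y3);
  (* (id (x) haar) Delta a = haar a = (haar (x) id) Delta a; recall that
     haar a = dot (reg a (Lam 1)) (Lam 1). *)
  haar_invr : forall a x y,
    dot (Delta a (tens l2l2 x (Lam 1))) (tens l2l2 y (Lam 1)) =
    haar a * dot x y;
  haar_invl : forall a x y,
    dot (Delta a (tens l2l2 (Lam 1) x)) (tens l2l2 (Lam 1) y) =
    haar a * dot x y }.

Section Corepresentations.
Context {R : realType} {G : hopf_cstar R}.
Local Notation A := (Cred G).
Local Notation C := R[i].

Definition lift_mx m n (T : 'M[C]_(m, n)) : 'M[A]_(m, n) :=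
  map_mx (in_alg A) T.

Definition conj_mx m n (u : 'M[A]_(m, n)) : 'M[A]_(m, n) := map_mx adj u.

(* u is unitary and Delta (u i j) = sum_k u i k (x) u k j. *)
Definition unitary_corep n (u : 'M[A]_n) :=
  [/\ (conj_mx u)^T *m u = 1%:M,
      u *m (conj_mx u)^T = 1%:M
    & forall i j x y, Delta (u i j) (tens (l2l2 G) x y) =
        \sum_k tens (l2l2 G) (reg (u i k) x) (reg (u k j) y)].

Definition intertwiner m n (u : 'M[A]_m) (v : 'M[A]_n) (T : 'M[C]_(n, m)) :=
  lift_mx T *m u = v *m lift_mx T.

Definition corep_equiv m n (u : 'M[A]_m) (v : 'M[A]_n) :=
  exists T (T' : 'M[C]_(m, n)),
    [/\ intertwiner u v T, T' *m T = 1%:M & T *m T' = 1%:M].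

Definition subcorep m n (u : 'M[A]_m) (v : 'M[A]_n) :=
  exists2 T, intertwiner u v T & \rank T = m.

(* The column space of V is u-invariant iff u V = V w for some w. *)
Definition irreducible_corep n (u : 'M[A]_n) :=
  (0 < n)%N /\
  forall k (V : 'M[C]_(n, k)) (w : 'M[A]_k),
    u *m lift_mx V = lift_mx V *m w -> \rank V = 0%N \/ \rank V = n.

(* w = ((id (x) S) v)^T, with S the antipode, since (id (x) S) v = v^-1. *)
Definition contragredient n (v w : 'M[A]_n) :=
  v *m w^T = 1%:M /\ w^T *m v = 1%:M.

Definition positive_definite n (F : 'M[C]_n) :=
  (map_mx Num.conj F)^T = F /\
  forall x : 'cV[C]_n, x != 0 -> 0 < ((map_mx Num.conj x)^T *m F *m x) 0 0.

(* The positive F, normalised by Tr F = Tr F^-1, intertwining u with its double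
   contragredient, which is F u F^-1.  For unitary u the contragredient is
   [conj_mx u]. *)
Definition modular_matrix n (u : 'M[A]_n) (F : 'M[C]_n) :=
  [/\ positive_definite F,
      \tr F = \tr (invmx F)
    & contragredient (conj_mx u)
        (lift_mx F *m u *m lift_mx (invmx F))].

Definition matrix_coefficients : set A :=
  [set a | exists n (u : 'M[A]_n) (c : 'M[C]_n),
     unitary_corep u /\ a = \sum_i \sum_j c i j *: u i j].

End Corepresentations.

Arguments matrix_coefficients {R} G.

(* Density of the matrix coefficients is equivalent to Woronowicz's density
   conditions on Delta(A)(A (x) 1) and Delta(A)(1 (x) A). *)
Record discrete_quantum_group (R : realType) := {
  dqg_hopf :> hopf_cstar R;
  dqg_dense : forall (a : Cred dqg_hopf) (e : R), 0 < e ->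
    exists2 b, matrix_coefficients dqg_hopf b & cnorm (a - b) < e }.

(* Irr(G), with a representative of each class written in an orthonormal basis
   in which its modular matrix is diagonal. *)
Record irreducibles (R : realType) (G : discrete_quantum_group R) := {
  irr :> choiceType;
  irr_dim : irr -> nat;
  irr_mx : forall al : irr, 'M[Cred G]_(irr_dim al);
  irr_unitary : forall al, unitary_corep (irr_mx al);
  irr_irreducible : forall al, irreducible_corep (irr_mx al);
  irr_modular : forall al, exists2 F, modular_matrix (irr_mx al) F &
    is_diag_mx F;
  irr_inj : forall al be, corep_equiv (irr_mx al) (irr_mx be) -> al = be;
  irr_full : forall n (v : 'M[Cred G]_n), unitary_corep v ->
    irreducible_corep v -> exists al, corep_equiv v (irr_mx al) }.

Section LengthFunctions.
Context {R : realType} {G : discrete_quantum_group R} {Irr : irreducibles G}.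
Implicit Types (al be ga : Irr) (l : Irr -> R).

Definition is_trivial al :=
  corep_equiv (irr_mx al) (1%:M : 'M[Cred G]_1).

Definition is_conjugate al be :=
  corep_equiv (irr_mx be) (conj_mx (irr_mx al)).

Definition length_function l :=
  [/\ forall al, 0 <= l al,
      forall al, is_trivial al -> l al = 0,
      forall al be, is_conjugate al be -> l be = l al
    & forall al be ga,
        subcorep (irr_mx al) (tensmx (irr_mx be) (irr_mx ga)) ->
        l al <= l be + l ga].

Definition proper_length l :=
  [/\ length_function l,
      forall n : nat, finite_set [set al | l al <= n%:R]
    & forall al, l al = 0 <-> is_trivial al].

Definition coef_index := {al : Irr & ('I_(irr_dim al) * 'I_(irr_dim al))%type}.

Definition coef_vector (k : coef_index) : l2 G :=
  Lam G (irr_mx (tag k) (tagged k).1 (tagged k).2).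

Definition length_operator l (x y : l2 G) :=
  exists a : coef_index -> R[i],
    [/\ partial_sum (fun k => a k *: coef_vector k) @ totally --> x,
        (\esum_(k in [set: coef_index])
          (l (tag k) ^+ 2 * complex.Re `|a k| ^+ 2 *
           complex.Re `|coef_vector k| ^+ 2)%:E < +oo)%E
      & partial_sum (fun k => ((l (tag k))%:C * a k) *: coef_vector k)
          @ totally --> y].

End LengthFunctions.

(* Main.v *)
(** The corepresentation u of an irreducible be is a unitary matrix (u_ij) over
    C[G], and for every irreducible ga the unitary be (x) ga is a direct sum of
    irreducibles.  Let y be the operator on the space of be (x) ga acting as
    l(al) on each copy of al.  Then D Lam(be (x) ga) = Lam((be (x) ga) y), so that
    [D, u] = u Z, where Z acts on the coefficients of ga as the matrix
    y - l(ga).  By the length inequality and Frobenius reciprocity,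
    |l(al) - l(ga)| <= l(be) whenever al is contained in be (x) ga, hence Z is
    bounded.  As Z commutes with D, the n-th iterated commutator of u is
    u Z^n, which gives the bounded commutators and the regularity at once
    (|D| = D because l >= 0).

    The Peter-Weyl theory behind this (complete reducibility, orthogonality of
    the coefficients, unitarisability of conjugates) is derived from the
    invariance of the Haar state and the density of the coefficients; D is then
    the diagonal operator of an orthogonal basis whose eigenvalues tend to
    infinity. *)
From HB Require Import structures.
From mathcomp Require Import all_boot all_order all_algebra spectral sesquilinear.
From mathcomp Require Import finmap complex mxtens.
From mathcomp Require Import all_classical all_reals all_analysis.
From mathcomp.analysis.showcase Require Import summability.
From mathcomp Require Import ring lra.
Require Import Defs.

Set Implicit Arguments.
Unset Strict Implicit.
Unset Printing Implicit Defensive.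

Import Order.TTheory GRing.Theory Num.Theory numFieldNormedType.Exports.

Local Open Scope classical_set_scope.
Local Open Scope ring_scope.
Local Open Scope complex_scope.
Local Notation "M ^t*" := (map_mx Num.conj (M^T)) (at level 30).
#[local] Existing Instance totally_filter.

(** * Hilbert spaces *)

(** Two obstacles shape the proof. For a unitary u over a C*-algebra, u P = P u P only makes the
    compression P u P an isometry, so the orthogonal complement of an invariant subspace is not
    obviously invariant. Complete reducibility therefore goes through the Haar state, at a stage
    where adjoints of coefficients are not yet known to be coefficients. Moreover the Haar state
    need not be a trace: the vectors Lam(u_ij) of one block have different norms, and an operator
    given by a matrix in these vectors need not inherit the norm of that matrix. Schur's lemma for u
    and for its conjugate shows that the norm of Lam(u_ij) depends on the row i only. Right
    multiplication by y mixes only column indices, so each entry of Z acts among vectors of equal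
    norm, and its bound is that of y - l(ga), uniformly in ga and without modular factors. All
    decompositions are kept orthogonal, so that bounds on the summands combine to a maximum rather
    than a sum. The diagonal form of F enters twice: in the orthogonality of the Lam(u_ij), and in
    the unitary form F^(1/2) conj(u) F^(-1/2) of the conjugate. *)

Section InnerProduct.
Context {C : numClosedFieldType} {H : hilbertType C}.
Implicit Types (x y z : H) (a : C).

Lemma dotC x y : dot x y = Num.conj (dot y x).
Proof. by rewrite hermC expr0 mul1r. Qed.

Lemma dotZl a x y : dot (a *: x) y = a * dot x y.
Proof. by rewrite linearZl_LR. Qed.

Lemma dotZr a x y : dot x (a *: y) = Num.conj a * dot x y.
Proof. by rewrite linearZr_LR. Qed.

Lemma dotxx_ge0 x : 0 <= dot x x.
Proof. by rewrite dot_norm exprn_ge0. Qed.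

Lemma dotxx_eq0 x : (dot x x == 0) = (x == 0).
Proof. by rewrite dot_norm sqrf_eq0 normr_eq0. Qed.

Lemma dot_ext x y : (forall z, dot x z = dot y z) -> x = y.
Proof.
move=> h; apply/eqP; rewrite -subr_eq0 -dotxx_eq0 linearBl /= h subrr; exact/eqP.
Qed.

Lemma cauchy_schwarz x y : `|dot x y| <= `|x| * `|y|.
Proof.
have [->|y0] := eqVneq y 0; first by rewrite linear0r normr0 mulr_ge0.
rewrite -(ler_pXn2r (n := 2)) ?nnegrE ?mulr_ge0 // exprMn -!dot_norm.
have n0 : 0 < dot y y by rewrite lt_def dotxx_eq0 y0 dotxx_ge0.
have := dotxx_ge0 (dot y y *: x - dot x y *: y).
rewrite linearBl !linearBr /= !dotZl !dotZr (dotC y x).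
rewrite !(conj_Creal (ger0_real (dotxx_ge0 y))) normCK.
have -> : forall a b c d : C, a * (a * b) - a * (d * c) - (c * (a * d) - c * (d * a))
   = a * (b * a - c * d) by move=> *; ring.
by rewrite pmulr_rge0 // subr_ge0.
Qed.

Lemma dot_cvgl (T : Type) (F : set_system T) {FF : Filter F} (f : T -> H) x y :
  f @ F --> x -> (fun t => dot (f t) y) @ F --> dot x y.
Proof.
move=> fx; apply/cvgrPdist_le => e e0.
have d0 : 0 < e / (`|y| + 1) by rewrite divr_gt0 // ltr_wpDl.
move/cvgrPdist_le: fx => /(_ _ d0); apply: filterS => t ht.
rewrite -linearBl; apply: (le_trans (cauchy_schwarz _ _)).
apply: (@le_trans _ _ (e / (`|y| + 1) * (`|y| + 1))).
  by apply: ler_pM => //; rewrite lerDl.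
by rewrite divfK // gt_eqF // ltr_wpDl.
Qed.

Lemma dot_near_cst (T : Type) (F : set_system T) {FF : ProperFilter F}
  (f : T -> H) x y a :
  f @ F --> x -> (\forall t \near F, dot (f t) y = a) -> dot x y = a.
Proof.
move=> /(dot_cvgl (y := y)) fx fa; apply: (norm_cvg_unique fx).
exact: cvg_near_cst.
Qed.

Lemma dot_near_ge0 (T : Type) (F : set_system T) {FF : ProperFilter F}
  (f : T -> H) x y :
  f @ F --> x -> (\forall t \near F, 0 <= dot (f t) y) -> 0 <= dot x y.
Proof.
move=> /(dot_cvgl (y := y)) fx f0; suff -> : dot x y = `|dot x y| by [].
apply: (norm_cvg_unique fx); apply: cvg_trans (cvg_norm fx).
by apply: near_eq_cvg; apply: filterS f0 => t /ger0_norm.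
Qed.

Lemma denseP (S : set H) :
  dense S <-> forall x (e : C), 0 < e -> exists2 s, S s & `|x - s| < e.
Proof.
split=> [dS x e e0|h O [x Ox] oO].
  have oB : open (ball x e) by exact: ball_open.
  have [|s [sB Ss]] := dS (ball x e) _ oB; first by exists x; exact: ballxx.
  by exists s => //; move: sB; rewrite -ball_normE.
have /nbhs_ballP[e /= e0 sub] : nbhs x O by exact: open_nbhs_nbhs.
have [s Ss xs] := h x e e0.
by exists s; split => //; apply: sub; rewrite -ball_normE.
Qed.

(** An element s of S within distance [|x|] of x would give [|x|^2 = |dot (x - s) x| < |x|^2] by
    Cauchy-Schwarz. *)
Lemma dot_dense_eq0 (S : set H) x :
  dense S -> (forall s, S s -> dot s x = 0) -> x = 0.
Proof.
move=> /denseP dS h; apply/eqP; apply/negPn/negP => x0.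
have nx0 : 0 < `|x| by rewrite normr_gt0.
have [s Ss sx] := dS x _ nx0.
have: dot (x - s) x = `|x| ^+ 2 by rewrite linearBl /= (h s Ss) subr0 dot_norm.
move/(congr1 Num.norm); rewrite normrX normr_id => e.
have := cauchy_schwarz (x - s) x.
by rewrite e expr2 ler_pM2r // => /(lt_le_trans sx); rewrite ltxx.
Qed.

End InnerProduct.

Section BoundedOperators.
Context {C : numClosedFieldType} {H : hilbertType C}.
Implicit Types (T S : H -> H).

(** The constant in [bounded_op] is an arbitrary scalar. A nonzero vector forces it to be
    nonnegative, but on the zero space nothing does; hence the passage to its modulus. *)
Lemma bounded_opP T : bounded_op T ->
  exists2 M : C, 0 <= M & forall x, `|T x| <= M * `|x|.
Proof.
move=> [_ [M hM]]; exists `|M| => // x.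
have [->|x0] := eqVneq x 0.
  by apply: (le_trans (hM 0)); rewrite normr0 !mulr0.
apply: (le_trans (hM x)); rewrite ler_pM2r ?normr_gt0 //.
have := le_trans (normr_ge0 _) (hM x).
by rewrite pmulr_lge0 ?normr_gt0 // => /ger0_norm ->.
Qed.

Lemma bounded_op0 T : bounded_op T -> T 0 = 0.
Proof. by move=> [lT _]; have := lT (-1) 0 0; rewrite scaler0 addr0 scaleN1r addNr. Qed.

Lemma bounded_opD T x y : bounded_op T -> T (x + y) = T x + T y.
Proof. by move=> [lT _]; have := lT 1 x y; rewrite !scale1r. Qed.

Lemma bounded_opZ T a x : bounded_op T -> T (a *: x) = a *: T x.
Proof. by move=> bT; have := bT.1 a x 0; rewrite (bounded_op0 bT) !addr0. Qed.

Lemma bounded_opN T x : bounded_op T -> T (- x) = - T x.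
Proof. by move=> bT; rewrite -scaleN1r bounded_opZ // scaleN1r. Qed.

Lemma bounded_op_sum T (I : Type) (r : seq I) (P : pred I) (f : I -> H) :
  bounded_op T -> T (\sum_(i <- r | P i) f i) = \sum_(i <- r | P i) T (f i).
Proof.
move=> bT; apply: (big_morph T) => [x y|]; [exact: bounded_opD|exact: bounded_op0].
Qed.

Lemma bounded_op_comb a T S :
  bounded_op T -> bounded_op S -> bounded_op (fun x => a *: T x + S x).
Proof.
move=> bT bS; split.
  move=> b x y; rewrite (bT.1) (bS.1) !scalerDr !scalerA (mulrC a b) -!addrA.
  by congr (_ + _); rewrite addrCA.
have [M M0 hM] := bounded_opP bT; have [N N0 hN] := bounded_opP bS.
exists (`|a| * M + N) => x; apply: (le_trans (ler_normD _ _)).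
by rewrite normrZ mulrDl lerD // -mulrA ler_wpM2l.
Qed.

Lemma bounded_op_zero : bounded_op (fun=> 0 : H).
Proof.
split=> [a x y|]; first by rewrite scaler0 addr0.
by exists 0 => x; rewrite normr0 mul0r.
Qed.

Lemma bounded_op_comp T S :
  bounded_op T -> bounded_op S -> bounded_op (fun x => T (S x)).
Proof.
move=> bT bS; split=> [a x y|]; first by rewrite bS.1 bT.1.
have [M M0 hM] := bounded_opP bT; have [N N0 hN] := bounded_opP bS.
exists (M * N) => x; apply: (le_trans (hM _)); rewrite -mulrA ler_wpM2l //.
Qed.

Lemma bounded_op_sum_op (I : Type) (r : seq I) (T : I -> H -> H) :
  (forall i, bounded_op (T i)) -> bounded_op (fun x => \sum_(i <- r) T i x).
Proof.
move=> bT; elim: r => [|i r IH].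
  by under eq_fun do rewrite big_nil; exact: bounded_op_zero.
under eq_fun do rewrite big_cons -[T i _]scale1r.
exact: bounded_op_comb.
Qed.

Lemma bounded_op_cvg T (U : Type) (F : set_system U) {FF : Filter F}
  (f : U -> H) x : bounded_op T -> f @ F --> x -> (fun u => T (f u)) @ F --> T x.
Proof.
move=> bT fx; have [M M0 hM] := bounded_opP bT.
apply/cvgrPdist_le => e e0.
have d0 : 0 < e / (M + 1) by rewrite divr_gt0 // ltr_wpDl.
move/cvgrPdist_le: fx => /(_ _ d0); apply: filterS => t ht.
rewrite -bounded_opN // -bounded_opD //; apply: (le_trans (hM _)).
apply: (@le_trans _ _ ((M + 1) * (e / (M + 1)))).
  by apply: ler_pM => //; rewrite lerDl.
by rewrite mulrC divfK // gt_eqF // ltr_wpDl.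
Qed.

End BoundedOperators.

(** * Unconditional convergence along finite subsets *)

Section UnconditionalSums.
Context {R : realType} {H : hilbertType R[i]} {I : choiceType}.
Implicit Types (F : {fset I}) (t : I -> H) (w : I -> R[i]).

Lemma partial_sumE (V : zmodType) (t : I -> V) F :
  partial_sum t F = \sum_(i <- F) t i.
Proof. by rewrite /partial_sum big_seq_fsetE. Qed.

Lemma partial_sum_sub (V : zmodType) (t : I -> V) F F0 : (F0 `<=` F)%fset ->
  partial_sum t F = partial_sum t F0 + partial_sum t (F `\` F0)%fset.
Proof.
move=> /fsubsetP sub; rewrite !partial_sumE (big_fsetID _ (mem F0)) /=.
have <- : F0 = [fset x in F | mem F0 x]%fset.
  by apply/fsetP => i; rewrite !inE; case: (boolP (i \in F0)) => [/sub ->|]; rewrite ?andbF.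
by congr (_ + _); apply: eq_fbigl => i; rewrite !inE andbC.
Qed.

(** [F0] is chosen with its sum within d of the supremum of all partial sums; real parts are taken
    because the supremum lives in R. *)
Lemma nonneg_tail_small w (B d : R[i]) : (forall i, 0 <= w i) ->
  (forall F, partial_sum w F <= B) -> 0 < d ->
  exists F0, forall F, partial_sum w F < partial_sum w F0 + d.
Proof.
move=> w0 wB d0.
have psr F : (complex.Re (partial_sum w F))%:C = partial_sum w F.
  by apply: RRe_real; apply: ger0_real; apply: sumr_ge0.
pose E := [set complex.Re (partial_sum w F) | F in [set: {fset I}]].
have dr : (complex.Re d)%:C = d by apply: RRe_real; exact: gtr0_real.
have supE : has_sup E.
  split; first by exists (complex.Re (partial_sum w fset0)), fset0.
  exists (complex.Re B) => _ [F _ <-].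
  by have := wB F; rewrite lecE => /andP[].
have d0' : 0 < complex.Re d by rewrite -ltcR dr.
have [_ [F0 _ <-] hF0] := sup_adherent d0' supE.
exists F0 => F; rewrite -(psr F) -(psr F0) -dr -rmorphD ltcR.
rewrite ltrBlDr in hF0; apply: le_lt_trans hF0.
by apply: (sup_ubound supE.2); exists F.
Qed.

(** Cauchy criterion: beyond [F0], a partial sum of t differs from the one over [F0] by a sum over
    the complement of [F0], which is controlled by the small tail of w. *)
Lemma partial_sum_cvg t w (B K : R[i]) : (forall i, 0 <= w i) ->
  (forall F, partial_sum w F <= B) -> 0 <= K ->
  (forall F, `|partial_sum t F| ^+ 2 <= K * partial_sum w F) ->
  cvg (partial_sum t @ totally).
Proof.
move=> w0 wB K0 ht; apply: cauchy_cvg.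
apply: cauchy_exP => e e0.
have K1 : 0 < K + 1 by rewrite ltr_wpDl.
have d0 : 0 < e ^+ 2 / (K + 1) by rewrite divr_gt0 // exprn_gt0.
have [F0 hF0] := nonneg_tail_small w0 wB d0.
exists (partial_sum t F0); exists F0 => // F /= sub.
rewrite -ball_normE /= (partial_sum_sub _ sub) opprD addrA subrr add0r normrN.
rewrite -(ltr_pXn2r (n := 2)) ?nnegrE ?(ltW e0) //.
apply: (le_lt_trans (ht _)).
have := hF0 F; rewrite (partial_sum_sub _ sub) ltrD2l => h.
apply: (@le_lt_trans _ _ ((K + 1) * partial_sum w (F `\` F0)%fset)).
  by rewrite ler_wpM2r ?lerDl //; apply: sumr_ge0.
by rewrite mulrC -ltr_pdivlMr.
Qed.

Lemma cvg_norm_le (T : Type) (F : set_system T) {FF : ProperFilter F} (f : T -> H)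
  x (B : R[i]) : f @ F --> x -> (\forall t \near F, `|f t| <= B) -> 0 <= B -> `|x| <= B.
Proof.
move=> fx fB B0; have rB : B \is Num.real by exact: ger0_real.
have rx : `|x| \is Num.real by [].
rewrite real_leNgt //; apply/negP => Bx.
have e0 : 0 < `|x| - B by rewrite subr_gt0.
move/cvgrPdist_lt: fx => /(_ _ e0) h.
have [t [/= h1 h2]] := filter_ex (filterI h fB).
have : `|x| <= `|x - f t| + `|f t| by rewrite -[X in `|X| <= _](subrK (f t)) ler_normD.
move=> /le_lt_trans; move=> /(_ (`|x| - B + B)).
by rewrite ltr_leD // subrK ltxx => /(_ isT).
Qed.

End UnconditionalSums.

(** * Expansions in an orthogonal basis, and operators prescribed on it *)

Section OrthogonalBasis.
Context {R : realType} {H : hilbertType R[i]} {I : choiceType} (e : I -> H).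
Context (orth : forall i j, i != j -> dot (e i) (e j) = 0).
Implicit Types (F : {fset I}) (x y z : H) (c : I -> R[i]).

Local Notation n i := (dot (e i) (e i)).
Local Notation S c F := (partial_sum (fun i => c i *: e i) F).

Lemma dot_partial_sum c F j : dot (S c F) (e j) = if j \in F then c j * n j else 0.
Proof.
rewrite partial_sumE linear_sumlz /=; case: ifPn => jF.
  rewrite (bigD1_seq j) ?fset_uniq //= dotZl big1 ?addr0 // => i ij.
  by rewrite dotZl orth // mulr0.
rewrite big_seq big1 // => i iF; rewrite dotZl orth ?mulr0 //.
by apply: contraNneq jF => <-.
Qed.

Lemma norm_partial_sum c F :
  `|S c F| ^+ 2 = partial_sum (fun i => `|c i| ^+ 2 * n i) F.
Proof.
rewrite [RHS]partial_sumE -dot_norm [X in dot _ X]partial_sumE linear_sumr /=.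
rewrite big_seq [RHS]big_seq.
apply: eq_bigr => i iF; rewrite dotZr dot_partial_sum iF mulrA normCK; congr (_ * _).
exact: mulrC.
Qed.

(* If [e i = 0], this is [0], as division by [0] yields [0]. *)
Definition coef x i := dot x (e i) / n i.

Lemma coefK x i : coef x i * n i = dot x (e i).
Proof.
rewrite /coef; have [n0|n0] := eqVneq (n i) 0; last by rewrite divfK.
have -> : e i = 0 by apply/eqP; rewrite -dotxx_eq0 n0.
by rewrite !linear0r.
Qed.

Lemma bessel x F : partial_sum (fun i => `|coef x i| ^+ 2 * n i) F <= `|x| ^+ 2.
Proof.
rewrite -norm_partial_sum; set s := S _ _.
have ds : dot x s = dot s s.
  rewrite {1 3}/s !partial_sumE !linear_sumr /= big_seq [RHS]big_seq.
  by apply: eq_bigr => i iF; rewrite !dotZr /s dot_partial_sum iF coefK.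
have : `|x - s| ^+ 2 = `|x| ^+ 2 - `|s| ^+ 2.
  rewrite -!dot_norm linearBl !linearBr /= (dotC s x) ds.
  by rewrite (conj_Creal (ger0_real (dotxx_ge0 s))); ring.
by move=> h; rewrite -subr_ge0 -h exprn_ge0.
Qed.

Lemma coef_series_weight c : forall i, 0 <= `|c i| ^+ 2 * n i.
Proof. by move=> i; rewrite mulr_ge0 ?exprn_ge0 ?dotxx_ge0. Qed.

Context (total : forall x, (forall i, dot x (e i) = 0) -> x = 0).

Lemma dot_basis_ext x y : (forall i, dot x (e i) = dot y (e i)) -> x = y.
Proof.
by move=> h; apply/eqP; rewrite -subr_eq0; apply/eqP; apply: total => i;
  rewrite linearBl /= h subrr.
Qed.

Lemma cvg_dot_basis c x i : partial_sum (fun i => c i *: e i) @ totally --> x ->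
  dot x (e i) = c i * n i.
Proof.
move=> cx; apply: (dot_near_cst cx).
by exists [fset i]%fset => // F /=; rewrite fsub1set dot_partial_sum => ->.
Qed.

(** Bessel's inequality gives convergence to some y, which has the same scalar products with the
    basis as x, so totality yields y = x. *)
Lemma coef_series_cvg x : partial_sum (fun i => coef x i *: e i) @ totally --> x.
Proof.
have /cvg_ex[y hy] : cvg (partial_sum (fun i => coef x i *: e i) @ totally).
  apply: (@partial_sum_cvg _ _ _ _ (fun i => `|coef x i| ^+ 2 * n i) (`|x| ^+ 2) 1) => //.
  - exact: coef_series_weight.
  - exact: bessel.
  - by move=> F; rewrite mul1r norm_partial_sum.
suff yx : y = x by rewrite yx in hy.
by apply: dot_basis_ext => i; rewrite (cvg_dot_basis _ hy) coefK.
Qed.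

Lemma norm_le_coef x z (B : R[i]) : 0 <= B ->
  (forall i, `|dot z (e i)| <= B * `|dot x (e i)|) -> `|z| <= B * `|x|.
Proof.
move=> B0 h; apply: (cvg_norm_le (@coef_series_cvg z)); last by rewrite mulr_ge0.
near=> F; rewrite -(ler_pXn2r (n := 2)) ?nnegrE ?mulr_ge0 //.
rewrite norm_partial_sum exprMn; apply: (le_trans _ (ler_wpM2l _ (bessel x F))); last first.
  by rewrite exprn_ge0.
rewrite !partial_sumE mulr_sumr; apply: ler_sum => i _.
rewrite mulrA ler_wpM2r ?dotxx_ge0 // -exprMn ler_pXn2r ?nnegrE ?mulr_ge0 //.
by rewrite /coef !normrM mulrA ler_wpM2r.
Unshelve. all: by end_near. Qed.

(** By orthogonality the right-hand sum is the squared norm of the combination of the [e i], so the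
    hypothesis bounds the map e i -> t i on finite combinations. The extension is defined directly
    by the series of coefficients. *)
Lemma extend_bounded (t : I -> H) (M : R[i]) : 0 <= M ->
  (forall c F, `|partial_sum (fun i => c i *: t i) F| ^+ 2 <=
     M * partial_sum (fun i => `|c i| ^+ 2 * n i) F) ->
  exists2 T, bounded_op T & forall i, T (e i) = t i.
Proof.
move=> M0 ht.
pose f x := partial_sum (fun i => coef x i *: t i).
have fcvg x : cvg (f x @ totally).
  apply: (@partial_sum_cvg _ _ _ _ (fun i => `|coef x i| ^+ 2 * n i) (`|x| ^+ 2) M) => //.
  - exact: coef_series_weight.
  - exact: bessel.
pose T x := lim (f x @ totally).
have TE x : f x @ totally --> T x by exact: fcvg.
exists T.
  split=> [a x y|].
    apply: norm_cvg_lim.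
    have -> : f (a *: x + y) = (fun F => a *: f x F + f y F).
      apply/funext => F; rewrite /f !partial_sumE scaler_sumr -big_split /=.
      apply: eq_bigr => i _; rewrite scalerA -scalerDl; congr (_ *: _).
      by rewrite /coef linearDl /= dotZl mulrDl mulrA.
    by apply: cvgD => //; apply: cvgZr.
  (* M bounds squared norms; as M <= (M + 1)^2, the constant M + 1 avoids a square root. *)
  exists (M + 1) => x; apply: (cvg_norm_le (TE x)); last by rewrite mulr_ge0 ?addr_ge0.
  near=> F; rewrite -(ler_pXn2r (n := 2)) ?nnegrE ?mulr_ge0 ?addr_ge0 //.
  apply: (le_trans (ht _ _)); rewrite exprMn.
  apply: (le_trans (ler_wpM2l M0 (bessel x F))).
  rewrite ler_wpM2r ?exprn_ge0 //.
  have -> : (M + 1) ^+ 2 = M + (M ^+ 2 + M + 1) by ring.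
  by rewrite lerDl !addr_ge0 ?exprn_ge0.
move=> i; apply: norm_cvg_lim; apply: cvg_near_cst; exists [fset i]%fset => // F /=.
rewrite fsub1set => iF; rewrite /f partial_sumE (bigD1_seq i) ?fset_uniq //=.
rewrite big1 => [|j ji]; last by rewrite /coef orth 1?eq_sym // mul0r scale0r.
rewrite addr0 /coef; have [n0|n0] := eqVneq (n i) 0; last by rewrite divff // scale1r.
(* When e i = 0, the coefficient is 0 by convention, and the hypothesis on the singleton {i} forces
   t i = 0. *)
rewrite n0 mul0r scale0r; apply/eqP; rewrite eq_sym -normr_eq0 -sqrf_eq0 eq_le exprn_ge0 // andbT.
have := ht (fun=> 1) [fset i]%fset.
by rewrite !partial_sumE !big_seq_fset1 n0 !mulr0 scale1r.
Unshelve. all: by end_near. Qed.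

Lemma diagonal_op (mu : I -> R[i]) (B : R[i]) :
  0 <= B -> (forall i, `|mu i| <= B) ->
  exists2 T, bounded_op T & forall x i, dot (T x) (e i) = mu i * dot x (e i).
Proof.
move=> B0 muB; have [|c F|T bT hT] := @extend_bounded (fun i => mu i *: e i) (B ^+ 2).
- by rewrite exprn_ge0.
- under [X in partial_sum X]eq_fun do rewrite scalerA.
  rewrite norm_partial_sum !partial_sumE mulr_sumr; apply: ler_sum => j _.
  rewrite mulrA ler_wpM2r ?dotxx_ge0 // -[in leRHS]exprMn ler_pXn2r ?nnegrE ?mulr_ge0 //.
  by rewrite normrM mulrC ler_wpM2r.
exists T => // x j.
apply: (dot_near_cst (bounded_op_cvg bT (@coef_series_cvg x))); exists [fset j]%fset => // F /=.
rewrite fsub1set => jF; rewrite partial_sumE bounded_op_sum // linear_sumlz /=.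
rewrite (bigD1_seq j) ?fset_uniq //= big1 => [|k kj].
  by rewrite bounded_opZ // hT !dotZl addr0 mulrCA coefK.
by rewrite bounded_opZ // hT !dotZl orth // !mulr0.
Qed.

End OrthogonalBasis.

(** * Diagonal operators *)

Section TotallyBounded.
Context {C : numClosedFieldType} {H : hilbertType C}.
Implicit Types (A B : set H) (x y v : H).

Definition totally_bounded A := forall e : C, 0 < e ->
  exists s : seq H, forall x, A x -> exists2 y, y \in s & `|x - y| < e.

Lemma ultra_cover (F : set_system H) {FU : UltraFilter F} (s : seq H)
  (U : H -> set H) (A : set H) : F A ->
  (forall x, A x -> exists2 y, y \in s & U y x) -> exists y, F (U y).
Proof.
elim: s A => [|y s IH] A FA h.
  by have [x /h[]] := filter_ex FA.
have [//|FUy] := in_ultra_setVsetC (U y) FU; first by exists y.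
apply: (IH _ (filterI FA FUy)) => x [/h[z]]; rewrite inE => /orP[/eqP -> //|zs] Uz _.
by exists z.
Qed.

(** An ultrafilter containing the closure of A contains a ball of any given radius, namely one of a
    finite cover; so it is Cauchy, and converges by completeness. Half of the radius is spent on
    passing from the closure to A. *)
Lemma totally_bounded_precompact A : totally_bounded A -> precompact A.
Proof.
move=> tbA; rewrite precompactE compact_ultra => F FU FA.
have [p Fp] : exists p : H, F --> p.
  apply/cvg_ex; apply: cauchy_cvg; apply: cauchy_exP => e e0.
  have e20 : 0 < e / 2 by rewrite divr_gt0.
  have [s hs] := tbA _ e20.
  apply: (ultra_cover (s := s) FA) => x /(_ (ball x (e / 2)) (nbhsx_ballx _ _ e20)).
  move=> [a [/hs[y ys ay] xa]]; exists y => //.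
  by rewrite (splitr e); apply: (@ball_triangle _ _ a); [rewrite -ball_normE /= distrC|exact: ball_sym].
exists p; split => //=; apply: (@closed_closure _ A) => B /Fp FB.
have [z [zA zB]] := filter_ex (filterI FA FB); by exists z.
Qed.

Lemma totally_bounded_subset A B : A `<=` B -> totally_bounded B -> totally_bounded A.
Proof. by move=> AB tB e /tB[s hs]; exists s => x /AB /hs. Qed.

Lemma totally_bounded_add A B : totally_bounded A -> totally_bounded B ->
  totally_bounded [set a + b | a in A & b in B].
Proof.
move=> tA tB e e0; have e20 : 0 < e / 2 by rewrite divr_gt0.
have [s hs] := tA _ e20; have [t ht] := tB _ e20.
exists [seq a + b | a <- s, b <- t] => _ [a Aa [b Bb <-]].
have [a' a's aa'] := hs _ Aa; have [b' b't bb'] := ht _ Bb.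
exists (a' + b'); first by apply/allpairsP; exists (a', b').
rewrite opprD addrACA (splitr e); apply: (le_lt_trans (ler_normD _ _)).
exact: ltrD.
Qed.

Lemma totally_bounded0 : totally_bounded [set 0].
Proof. by move=> e e0; exists [:: 0] => x ->; exists 0; rewrite ?inE // subrr normr0. Qed.

Lemma totally_bounded_sum (I : Type) (r : seq I) (A : I -> set H) :
  (forall i, totally_bounded (A i)) ->
  totally_bounded [set \sum_(i <- r) f i | f in [set f | forall i, A i (f i)]].
Proof.
move=> tA; elim: r => [|i r IH].
  by apply: totally_bounded_subset totally_bounded0 => _ [f _ <-]; rewrite big_nil.
apply: totally_bounded_subset (totally_bounded_add (tA i) IH) => _ [f hf <-].
by rewrite big_cons; exists (f i) => //; exists (\sum_(j <- r) f j) => //; exists f.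
Qed.

(** This is how a norm limit of finite rank operators is seen to be compact. *)
Lemma totally_bounded_approx A :
  (forall e : C, 0 < e -> exists2 B, totally_bounded B &
     forall x, A x -> exists2 y, B y & `|x - y| < e) -> totally_bounded A.
Proof.
move=> h e e0; have e20 : 0 < e / 2 by rewrite divr_gt0.
have [B tB hB] := h _ e20; have [s hs] := tB _ e20.
exists s => x /hB[y /hs[z zs yz] xy]; exists z => //.
rewrite -(subrKA y) (splitr e); apply: (le_lt_trans (ler_normD _ _)).
exact: ltrD.
Qed.

End TotallyBounded.

Section TotallyBoundedDisc.
Context {R : realType} {H : hilbertType R[i]}.

Lemma totally_bounded_segment (v : H) (M : R) :
  totally_bounded [set t%:C *: v | t in [set t : R | `|t| <= M]].
Proof.
move=> e e0.
have er : (complex.Re e)%:C = e by apply: RRe_real; exact: gtr0_real.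
have vr : (complex.Re `|v|)%:C = `|v| by apply: RRe_real.
(* The mesh d satisfies d |v| < e, also when v = 0 thanks to the added 1. The net consists of the
   points j d - M that cover [-M, M]. *)
pose d := complex.Re e / (complex.Re `|v| + 1).
have e0' : 0 < complex.Re e by rewrite -ltcR er.
have v0 : 0 <= complex.Re `|v| by rewrite -lecR vr; exact: normr_ge0.
have d0 : 0 < d by rewrite divr_gt0 // ltr_wpDl.
have [N hN] : exists N, (Num.truncn (2 * M / d) < N)%N by exists (Num.truncn (2 * M / d)).+1.
exists [seq (j%:R * d - M)%:C *: v | j <- iota 0 N].
move=> _ [t /= tM <-]; move: tM; rewrite ler_norml => /andP[t1 t2].
have s0 : 0 <= (t + M) / d by rewrite divr_ge0 ?(ltW d0) // -lerBlDr sub0r.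
exists (((Num.truncn ((t + M) / d))%:R * d - M)%:C *: v).
  apply: (map_f (fun j : nat => (j%:R * d - M)%:C *: v)).
  rewrite mem_iota /= add0n (leq_ltn_trans _ hN) // le_truncn // ler_pM2r ?invr_gt0 //; lra.
rewrite -scalerBl normrZ -rmorphB.
have /andP[h1 h2] := truncn_itv s0.
set j := (Num.truncn _)%:R in h1 *.
rewrite -natr1 -/j in h2.
rewrite ler_pdivlMr // in h1; rewrite ltr_pdivrMr // mulrDl mul1r in h2.
have hn : `|t - (j * d - M)| <= d by rewrite ler_norml; apply/andP; split; lra.
have -> : `|(t - (j * d - M))%:C| = `|t - (j * d - M)|%:C :> R[i].
  by rewrite normc_def /= expr0n /= addr0 sqrtr_sqr.
rewrite -vr -er -rmorphM ltcR.
apply: (@le_lt_trans _ _ (d * complex.Re `|v|)); first by rewrite ler_wpM2r.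
by rewrite /d mulrAC ltr_pdivrMr ?ltr_wpDl // ltr_pM2l // ltrDl.
Qed.

(** The disc is contained in a square, the sum of a segment along v and one along 'i v. *)
Lemma totally_bounded_disc (v : H) (M : R[i]) :
  totally_bounded [set c *: v | c in [set c : R[i] | `|c| <= M]].
Proof.
apply: totally_bounded_subset (totally_bounded_add
  (totally_bounded_segment v (complex.Re M))
  (totally_bounded_segment ('i *: v) (complex.Re M))) => _ [[a b] /= cM <-].
have /andP[_ cM'] : (complex.Im M == complex.Im `|a +i* b|) && (complex.Re `|a +i* b| <= complex.Re M).
  by rewrite -lecE.
move: cM'; rewrite normc_def /= => cM'.
exists (a%:C *: v); first exists a => //=.
  by apply: le_trans cM'; rewrite -sqrtr_sqr ler_wsqrtr // lerDl sqr_ge0.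
exists (b%:C *: ('i *: v)); first exists b => //=.
  by apply: le_trans cM'; rewrite -sqrtr_sqr ler_wsqrtr // lerDr sqr_ge0.
by rewrite scalerA -scalerDl (complexE (a +i* b)) /= [b%:C * _]mulrC.
Qed.

End TotallyBoundedDisc.

Lemma conj_real_complex (R : rcfType) (r : R) : Num.conj (r%:C : R[i]) = r%:C.
Proof. by rewrite conj_Creal ?complex_real. Qed.

(** * Self-adjointness, commutators and resolvent of a diagonal operator *)

Section DiagonalOperator.
Context {R : realType} {H : hilbertType R[i]} {I : choiceType} (e : I -> H).
Context (orth : forall i j, i != j -> dot (e i) (e j) = 0).
Context (total : forall x, (forall i, dot x (e i) = 0) -> x = 0).
Context (lam : I -> R).
Implicit Types (F : {fset I}) (x y z : H) (c : I -> R[i]).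

(** The graph is read off scalar products with the basis. That y exists in H already encodes the
    square-summability that defines the domain. *)
Definition diagop x y := forall i, dot y (e i) = (lam i)%:C * dot x (e i).

Local Notation n i := (dot (e i) (e i)).
Local Notation S c F := (partial_sum (fun i => c i *: e i) F).
Let coef_cvg x := @coef_series_cvg R H I e orth total x.

Lemma diagop_coef x y i : diagop x y -> coef e y i = (lam i)%:C * coef e x i.
Proof. by move=> h; rewrite /coef h mulrA. Qed.

Lemma diagop_partial_sum c F : diagop (S c F) (S (fun i => (lam i)%:C * c i) F).
Proof.
by move=> i; rewrite !dot_partial_sum //; case: ifP; rewrite ?mulr0 ?mulrA.
Qed.

Lemma diagop_coef_cvg x y : diagop x y ->
  partial_sum (fun i => ((lam i)%:C * coef e x i) *: e i) @ totally --> y.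
Proof.
move=> Dxy; have := @coef_cvg y.
by under [X in partial_sum X]eq_fun do rewrite (diagop_coef _ Dxy).
Qed.

Lemma diagop_series x y c :
  partial_sum (fun i => c i *: e i) @ totally --> x ->
  partial_sum (fun i => ((lam i)%:C * c i) *: e i) @ totally --> y -> diagop x y.
Proof.
move=> hx hy i; rewrite (cvg_dot_basis orth i hx).
by rewrite (cvg_dot_basis orth i hy) mulrA.
Qed.

Lemma diagop_comb a x y x' y' :
  diagop x y -> diagop x' y' -> diagop (a *: x + x') (a *: y + y').
Proof. by move=> h h' i; rewrite !linearDl /= !dotZl h h' mulrDr mulrCA. Qed.

Lemma diagop0 : diagop 0 0.
Proof. by move=> i; rewrite linear0l mulr0. Qed.

Lemma diagop_sum (J : Type) (r : seq J) (f g : J -> H) :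
  (forall j, diagop (f j) (g j)) -> diagop (\sum_(j <- r) f j) (\sum_(j <- r) g j).
Proof.
move=> h; elim: r => [|j r IH]; first by rewrite !big_nil; exact: diagop0.
by rewrite !big_cons -[f j]scale1r -[g j]scale1r; exact: diagop_comb.
Qed.

Lemma diagop_symmetric v w x y : diagop v w -> diagop x y -> dot w x = dot v y.
Proof.
move=> Dvw Dxy.
have /(dot_cvgl (y := x)) hw := diagop_coef_cvg Dvw.
have /(dot_cvgl (y := y)) hv := @coef_cvg v.
apply: (norm_cvg_unique hw); suff -> : (fun F => dot (S (fun i => (lam i)%:C * coef e v i) F) x)
  = (fun F => dot (S (coef e v) F) y) by [].
apply/funext => F; rewrite !partial_sumE !linear_sumlz; apply: eq_bigr => i _ /=.
rewrite !dotZl (dotC (e i) x) (dotC (e i) y) Dxy rmorphM /=.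
by rewrite conj_real_complex [RHS]mulrA; congr (_ * _); exact: mulrC.
Qed.

(** Finite combinations of the basis lie in the domain, so it is dense. Testing a pair of the
    adjoint against the eigenvectors [e i] gives back the defining relation, so the adjoint is no
    larger. *)
Lemma diagop_selfadjoint : selfadjoint diagop.
Proof.
split.
  apply/denseP => x r r0; have := @coef_cvg x => /cvgrPdist_lt /(_ _ r0) h.
  have [F /= hF] := filter_ex h.
  exists (S (coef e x) F) => //; eexists; exact: diagop_partial_sum.
move=> x y; split=> [Dxy v w Dvw|h i]; first exact: diagop_symmetric.
have De : diagop (e i) ((lam i)%:C *: e i).
  move=> j; rewrite dotZl; have [->//|ij] := eqVneq i j.
  by rewrite orth // !mulr0.
have := h _ _ De; rewrite dotZl (dotC (e i)) (dotC (e i) y) => /(congr1 Num.conj).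
by rewrite rmorphM /= !conjCK conj_real_complex.
Qed.

(** The basis suffices: the partial sums of x converge together with their images under D, and
    boundedness of T and K carries the relation to the limit. Closedness of D takes the form of
    moving [lam j] to the second argument of [dot]. *)
Lemma diagop_commutator (T K : H -> H) : bounded_op T -> bounded_op K ->
  (forall i, diagop (T (e i)) (K (e i) + (lam i)%:C *: T (e i))) ->
  commutator diagop T K.
Proof.
move=> bT bK h x y Dxy j.
have /(bounded_op_cvg bK) hK := @coef_cvg x.
have /(bounded_op_cvg bT) hT := @coef_cvg x.
have /(bounded_op_cvg bT) hT' := diagop_coef_cvg Dxy.
have /(dot_cvgl (y := e j)) h1 : (fun F => K (S (coef e x) F) +
    T (S (fun i => (lam i)%:C * coef e x i) F)) @ totally --> K x + T y by exact: cvgD.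
have /(dot_cvgl (y := (lam j)%:C *: e j)) h2 := hT.
have <- : dot (T x) ((lam j)%:C *: e j) = (lam j)%:C * dot (T x) (e j).
  by rewrite dotZr conj_real_complex.
apply: (norm_cvg_unique h1).
suff -> : (fun F => dot (K (S (coef e x) F) +
     T (S (fun i => (lam i)%:C * coef e x i) F)) (e j)) =
  (fun F => dot (T (S (coef e x) F)) ((lam j)%:C *: e j)) by [].
apply/funext => F /=; rewrite !partial_sumE !(bounded_op_sum _ _ _ bT) (bounded_op_sum _ _ _ bK) linearDl /= !linear_sumlz /=.
rewrite -big_split /=; apply: eq_bigr => i _.
have := h i j; rewrite !(bounded_opZ _ _ bT) (bounded_opZ _ _ bK) linearDl /= !dotZl dotZr.
by rewrite conj_real_complex => <-; ring.
Qed.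

Lemma diagop_abs : (forall i, 0 <= lam i) -> op_abs diagop diagop.
Proof.
move=> lam0; split=> //; first exact: diagop_selfadjoint.
move=> x y Dxy; apply: (dot_near_ge0 (diagop_coef_cvg Dxy)).
near=> F; rewrite /= partial_sumE linear_sumlz /=; apply: sumr_ge0 => i _.
rewrite dotZl (dotC (e i)) -coefK // rmorphM /= (conj_Creal (ger0_real (dotxx_ge0 _))).
rewrite -mulrA mulr_ge0 ?ler0c // mulrA -normCK.
exact: coef_series_weight.
Unshelve. all: by end_near. Qed.

Lemma diagop_compact_resolvent :
  (forall N : nat, finite_set [set i | lam i <= N%:R]) -> (forall i, 0 <= lam i) ->
  compact_resolvent diagop.
Proof.
move=> fin lam0.
pose mu i : R := (1 + lam i ^+ 2)^-1.
have d0 i : 0 < 1 + lam i ^+ 2 by rewrite ltr_pwDl // sqr_ge0.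
have mu0 i : 0 <= mu i by rewrite invr_ge0 ltW.
have mu1 i : mu i <= 1 by rewrite invf_le1 // lerDl sqr_ge0.
have normR (t : R) : `|t%:C| = `|t|%:C :> R[i].
  by rewrite normc_def /= expr0n /= addr0 sqrtr_sqr.
have [|K bK hK] := @diagonal_op R H I e orth total (fun i => (mu i)%:C) 1 ler01.
  by move=> i; rewrite normR lecR ger0_norm.
(* L is D (1 + D^2)^-1; it supplies the intermediate vector D x demanded by [op_comp]. *)
have [|L bL hL] := @diagonal_op R H I e orth total (fun i => (lam i * mu i)%:C) 1 ler01.
  move=> i; rewrite normR lecR ger0_norm ?mulr_ge0 // ler_pdivrMr // mul1r.
  by have := sqr_ge0 (lam i - 1); have := lam0 i; nra.
exists K; last first.
  move=> x z; split=> [[y Dxy Dyz]|->].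
    apply: (dot_basis_ext total) => i; rewrite hK.
    have := Dyz i; rewrite Dxy linearBl /= => /eqP; rewrite subr_eq => /eqP ->.
    have -> : (lam i)%:C * ((lam i)%:C * dot x (e i)) + dot x (e i) =
       (1 + lam i ^+ 2)%:C * dot x (e i).
      by rewrite rmorphD rmorphXn /=; ring.
    by rewrite mulrA -rmorphM mulVf ?gt_eqF // mul1r.
  exists (L z) => i; first by rewrite hL hK rmorphM mulrA.
  rewrite hL linearBl /= hK mulrA -rmorphM.
  have -> : lam i * (lam i * mu i) = 1 - mu i.
    by rewrite /mu; field; rewrite gt_eqF.
  by rewrite rmorphB mulrBl mul1r.
split; first exact: bK.1.
apply: totally_bounded_precompact; apply: totally_bounded_approx => r r0.
have rr : (complex.Re r)%:C = r by apply: RRe_real; exact: gtr0_real.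
have r0' : 0 < complex.Re r by rewrite -ltcR rr.
(* N satisfies 1/N < r. Where lam > N >= 1, the eigenvalue 1/(1 + lam^2) is at most 1/N, so cutting
   K off to the finite set [F] costs less than r. *)
pose N := (Num.truncn (complex.Re r)^-1).+1.
have hN : (complex.Re r)^-1 < N%:R by exact: truncnS_gt.
pose F := fset_set [set i | lam i <= N%:R].
(* The radius is the Cauchy-Schwarz bound on the coefficient of K x at [e i] for x in the unit
   ball. *)
pose A i := [set c *: e i | c in [set c : R[i] | `|c| <= `|(n i)^-1| * `|e i|]].
exists [set \sum_(i <- F) f i | f in [set f | forall i, A i (f i)]].
  by apply: (totally_bounded_sum F (A := A)) => i; exact: totally_bounded_disc.
move=> _ [x /= x1 <-]; exists (S (coef e (K x)) F).
  rewrite partial_sumE; exists (fun i => coef e (K x) i *: e i) => //= i.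
  exists (coef e (K x) i) => //=; rewrite /coef hK !normrM mulrC.
  rewrite ler_wpM2l // (le_trans (y := 1 * `|dot x (e i)|)) //.
    by rewrite ler_wpM2r // normR lecR ger0_norm.
  rewrite mul1r; apply: (le_trans (cauchy_schwarz _ _)).
  by rewrite -[leRHS]mul1r ler_wpM2r.
apply: (@le_lt_trans _ _ (N%:R^-1%:C * `|x|)).
  apply: (norm_le_coef orth total); first by rewrite ler0c invr_ge0.
  move=> i; rewrite linearBl /= dot_partial_sum //; case: ifPn => iF.
    by rewrite coefK subrr normr0 mulr_ge0 // ler0c invr_ge0.
  rewrite subr0 hK normrM ler_wpM2r // normR lecR ger0_norm //.
  have : N%:R < lam i.
    rewrite ltNge; apply: contra iF => iN.
    by rewrite in_fset_set ?inE.
  have N1 : (1 : R) <= N%:R by rewrite ler1n.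
  by move=> Nl; rewrite lef_pV2 ?posrE // ?ltr0n //; nra.
apply: (@le_lt_trans _ _ N%:R^-1%:C).
  by rewrite ler_piMr // ler0c invr_ge0.
by rewrite -rr ltcR invf_plt ?posrE ?ltr0n.
Qed.

End DiagonalOperator.

(** * Identities extended from a dense set *)

Section DenseExtension.
Context {C : numClosedFieldType} {H : hilbertType C}.

Lemma dense_lipschitz_eq0 (V : normedZmodType C) (S : set H) (f : H -> V) (K : C) :
  dense S -> (forall x y, `|f x - f y| <= K * `|x - y|) ->
  (forall s, S s -> f s = 0) -> forall x, f x = 0.
Proof.
move=> /denseP dS fK fS x; apply/eqP; apply/negPn/negP => fx0.
have n0 : 0 < `|f x| by rewrite normr_gt0.
have [K0|K0] := eqVneq K 0.
  have [s Ss _] := dS x 1 ltr01.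
  by have := fK x s; rewrite K0 mul0r (fS s Ss) subr0 real_leNgt ?n0 // ger0_real.
have d0 : 0 < `|f x| / `|K| by rewrite divr_gt0 // normr_gt0.
have [s Ss sx] := dS x _ d0.
have := fK x s; rewrite (fS s Ss) subr0 => h.
have h' : `|f x| <= `|K| * `|x - s|.
  have hn : 0 <= K * `|x - s| by apply: le_trans h.
  by rewrite -[X in _ * X]normr_id -normrM (ger0_norm hn).
move: sx; rewrite ltr_pdivlMr ?normr_gt0 // mulrC => /(le_lt_trans h').
by rewrite ltxx.
Qed.

Lemma bounded_op_dense_ext (S : set H) (T U : H -> H) :
  dense S -> bounded_op T -> bounded_op U -> (forall s, S s -> T s = U s) ->
  forall x, T x = U x.
Proof.
move=> dS bT bU h x; apply/eqP; rewrite -subr_eq0; apply/eqP.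
have [K K0 hK] := bounded_opP (bounded_op_comb (-1) bU bT).
apply: (@dense_lipschitz_eq0 H S (fun x => T x - U x) K dS) => [y z|s Ss].
  have -> : T y - U y - (T z - U z) = -1 *: U (y - z) + T (y - z).
    rewrite (bounded_opD _ _ bT) (bounded_opN _ bT) (bounded_opD _ _ bU).
    by rewrite (bounded_opN _ bU) scaleN1r !opprD !opprK addrACA addrC.
  exact: hK.
by rewrite h // subrr.
Qed.

End DenseExtension.

Section StarAlgebra.
Context {C : numClosedFieldType} {A : starAlgType C}.
Implicit Types a b : A.

Lemma adj0 : adj (0 : A) = 0.
Proof. by apply: (addrI (adj (0 : A))); rewrite -adjD !addr0. Qed.

Lemma adj_sum (I : Type) (r : seq I) (P : pred I) (f : I -> A) :
  adj (\sum_(i <- r | P i) f i) = \sum_(i <- r | P i) adj (f i).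
Proof. by apply: (big_morph adj) => [x y|]; [exact: adjD|exact: adj0]. Qed.

Lemma adj1 : adj (1 : A) = 1.
Proof. by rewrite -[LHS]mulr1 -{2}(adjK (1 : A)) -adjM mulr1 adjK. Qed.

End StarAlgebra.

(** * Corepresentations and the Haar state *)

Section HopfAlgebra.
Context {R : realType} {G : hopf_cstar R}.
Local Notation A := (Cred G).
Local Notation C := R[i].
Local Notation h := (@haar R G).
Local Notation "x \ox y" := (tens (l2l2 G) x y) (at level 40).
Implicit Types (a b c : A) (x y : l2 G).

Lemma haarE a : h a = dot (Lam G a) (Lam G 1).
Proof. by rewrite Lam_dot adj1 mul1r. Qed.

Lemma haar_adj a : h (adj a) = Num.conj (h a).
Proof. by rewrite haarE Lam_dot adj1 mul1r -[adj a]mulr1 -Lam_dot dotC -haarE. Qed.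

Lemma norm_Lam1 : `|Lam G 1| = 1.
Proof.
apply/eqP; rewrite -(eqrXn2 (n := 2)) // -dot_norm -haarE haar1 expr1n //.
Qed.

Lemma norm_Lam a : `|Lam G a| <= (cnorm a)%:C.
Proof.
by have := reg_bound a (Lam G 1); rewrite reg_Lam mulr1 norm_Lam1 mulr1.
Qed.

Lemma norm_haar a : `|h a| <= (cnorm a)%:C.
Proof.
rewrite haarE; apply: (le_trans (cauchy_schwarz _ _)); rewrite norm_Lam1 mulr1.
exact: norm_Lam.
Qed.

Lemma reg_bounded a : bounded_op (@reg R G a).
Proof. by split; [exact: reg_linear|exists (cnorm a)%:C => x; exact: reg_bound]. Qed.

(** On the dense set of vectors [Lam c] this is an identity in the algebra; [regM] and [reg1] are
    obtained in the same way. *)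
Lemma reg_comb (z : C) a b x : reg (z *: a + b) x = z *: reg a x + reg b x.
Proof.
apply: (bounded_op_dense_ext (@Lam_dense R G) (reg_bounded (z *: a + b))
  (bounded_op_comb z (reg_bounded a) (reg_bounded b))) => _ [c _ <-].
by rewrite !reg_Lam mulrDl -scalerAl linearP.
Qed.

Lemma regM a b x : reg (a * b) x = reg a (reg b x).
Proof.
apply: (bounded_op_dense_ext (@Lam_dense R G) (reg_bounded (a * b))
  (bounded_op_comp (reg_bounded a) (reg_bounded b))) => _ [c _ <-].
by rewrite !reg_Lam mulrA.
Qed.

Lemma reg1 x : reg (1 : A) x = x.
Proof.
have b1 : bounded_op (@id (l2 G)) by split=> //; exists 1 => y; rewrite mul1r.
apply: (bounded_op_dense_ext (@Lam_dense R G) (reg_bounded 1) b1) => _ [c _ <-].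
by rewrite reg_Lam mul1r.
Qed.

Lemma reg0 x : reg (0 : A) x = 0.
Proof. by have := reg_comb (-1) 0 0 x; rewrite scaler0 addr0 scaleN1r addNr. Qed.

Lemma regD a b x : reg (a + b) x = reg a x + reg b x.
Proof. by have := reg_comb 1 a b x; rewrite !scale1r. Qed.

Lemma regZ (z : C) a x : reg (z *: a) x = z *: reg a x.
Proof. by have := reg_comb z a 0 x; rewrite reg0 !addr0. Qed.

Lemma reg_sum (I : Type) (r : seq I) (P : pred I) (f : I -> A) x :
  reg (\sum_(i <- r | P i) f i) x = \sum_(i <- r | P i) reg (f i) x.
Proof.
by apply: (big_morph (fun a => reg a x)) => [a b|]; [exact: regD|exact: reg0].
Qed.

Lemma reg_inj a b : (forall x, reg a x = reg b x) -> a = b.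
Proof.
move=> hab; apply/eqP; rewrite -subr_eq0; apply/eqP.
apply: (reg_faithful (h := G)) => // x.
by rewrite -scaleN1r addrC reg_comb scaleN1r hab addNr.
Qed.

Lemma reg_dot_inj a b : (forall x y, dot (reg a x) y = dot (reg b x) y) -> a = b.
Proof. by move=> hab; apply: reg_inj => x; apply: dot_ext => y. Qed.

Lemma reg_adj a x y : dot (reg a x) y = dot x (reg (adj a) y).
Proof.
pose f x y := dot (reg a x) y - dot x (reg (adj a) y).
have fB1 u v w : f u w - f v w = dot (reg a (u - v)) w - dot (u - v) (reg (adj a) w).
  rewrite (bounded_opD _ _ (reg_bounded a)) (bounded_opN _ (reg_bounded a)).
  by rewrite !linearBl /= /f; ring.
have fB2 u v w : f w u - f w v = dot (reg a w) (u - v) - dot w (reg (adj a) (u - v)).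
  by rewrite (bounded_opD _ _ (reg_bounded (adj a))) (bounded_opN _ (reg_bounded (adj a)))
    !linearBr /= /f; ring.
(* The sesquilinear form f is bounded, hence Lipschitz in each variable separately, and the density
   argument can be run once in each. *)
have bnd u w : `|dot (reg a u) w - dot u (reg (adj a) w)| <=
    ((cnorm a)%:C + (cnorm (adj a))%:C) * `|u| * `|w|.
  apply: (le_trans (ler_normB _ _)); rewrite 2!mulrDl lerD //.
    by apply: (le_trans (cauchy_schwarz _ _)); rewrite ler_wpM2r ?reg_bound.
  apply: (le_trans (cauchy_schwarz _ _)); rewrite mulrAC mulrC ler_wpM2r //.
  exact: reg_bound.
have dL := @Lam_dense R G.
suff : f x y = 0 by move/eqP; rewrite subr_eq0 => /eqP.
move: x; apply: (dense_lipschitz_eq0 (V := C) dL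
   (K := ((cnorm a)%:C + (cnorm (adj a))%:C) * `|y|)) => [u v|_ [b _ <-]].
  by rewrite fB1 mulrAC bnd.
move: y; apply: (dense_lipschitz_eq0 (V := C) dL
   (K := ((cnorm a)%:C + (cnorm (adj a))%:C) * `|Lam G b|)) => [u v|_ [c _ <-]].
  by rewrite fB2 bnd.
by rewrite /f !reg_Lam !Lam_dot adjM adjK mulrA subrr.
Qed.

Lemma tens_ext (z w : l2l2 G) :
  (forall x y, dot z (x \ox y) = dot w (x \ox y)) -> z = w.
Proof.
move=> zw; apply/eqP; rewrite -subr_eq0; apply/eqP.
apply: (dot_dense_eq0 (@tens_dense _ _ (l2l2 G))) => _ [n [x [y ->]]].
rewrite linear_sumlz big1 //= => i _; rewrite dotC linearBl /= zw subrr.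
exact: conjC0.
Qed.

Lemma Delta_bounded a : bounded_op (@Delta R G a).
Proof. by have [] := @Delta_hom R G => /(_ a I). Qed.

Lemma Delta_comb (z : C) a b w : Delta (z *: a + b) w = z *: Delta a w + Delta b w.
Proof. by have [_ ->] := @Delta_hom R G. Qed.

Lemma DeltaM a b w : Delta (a * b) w = Delta a (Delta b w).
Proof. by have [_ _ ->] := @Delta_hom R G. Qed.

Lemma Delta_adj a z w : dot (Delta a z) w = dot z (Delta (adj a) w).
Proof. by have [_ _ _ ->] := @Delta_hom R G. Qed.

Lemma Delta0 w : Delta (0 : A) w = 0.
Proof. by have := Delta_comb (-1) 0 0 w; rewrite scaler0 addr0 scaleN1r addNr. Qed.

Lemma DeltaZ (z : C) a w : Delta (z *: a) w = z *: Delta a w.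
Proof. by have := Delta_comb z a 0 w; rewrite Delta0 !addr0. Qed.

Lemma Delta_sum (I : Type) (r : seq I) (P : pred I) (f : I -> A) w :
  Delta (\sum_(i <- r | P i) f i) w = \sum_(i <- r | P i) Delta (f i) w.
Proof.
apply: (big_morph (fun a => Delta a w)) => [a b|]; last exact: Delta0.
by have := Delta_comb 1 a b w; rewrite !scale1r.
Qed.

(** Delta a = sum_j b_j (x) c_j in the algebraic tensor product, read on elementary tensors through
    [reg]. *)
Definition coproduct (J : finType) a (b c : J -> A) :=
  forall x y, Delta a (x \ox y) = \sum_j (reg (b j) x) \ox (reg (c j) y).

Lemma coproductM (J K : finType) a b (a1 a2 : J -> A) (b1 b2 : K -> A) :
  coproduct a a1 a2 -> coproduct b b1 b2 ->
  coproduct (a * b) (fun jk : J * K => a1 jk.1 * b1 jk.2)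
    (fun jk => a2 jk.1 * b2 jk.2).
Proof.
move=> ha hb x y; rewrite DeltaM hb (bounded_op_sum _ _ _ (Delta_bounded a)).
under eq_bigr do rewrite ha.
rewrite exchange_big pair_big /=.
by apply: eq_bigr => jk _; rewrite !regM.
Qed.

Lemma coproduct_adj (J : finType) a (b c : J -> A) :
  coproduct a b c -> coproduct (adj a) (fun j => adj (b j)) (fun j => adj (c j)).
Proof.
move=> hc x y; apply: tens_ext => x' y'.
rewrite Delta_adj adjK hc linear_sumr linear_sumlz /=; apply: eq_bigr => j _.
by rewrite !tens_dot !reg_adj !adjK.
Qed.

(** [haar_invl] is the matrix element of this identity between x and y; faithfulness of [reg]
    removes the vectors. *)
Lemma haar_left (J : finType) a (b c : J -> A) : coproduct a b c ->
  \sum_j h (b j) *: c j = h a *: 1.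
Proof.
move=> hc; apply: reg_dot_inj => x y; rewrite regZ reg1 dotZl -haar_invl hc.
rewrite reg_sum !linear_sumlz /=; apply: eq_bigr => j _.
by rewrite tens_dot regZ dotZl reg_Lam mulr1 -haarE.
Qed.

Lemma haar_right (J : finType) a (b c : J -> A) : coproduct a b c ->
  \sum_j h (c j) *: b j = h a *: 1.
Proof.
move=> hc; apply: reg_dot_inj => x y; rewrite regZ reg1 dotZl -haar_invr hc.
rewrite reg_sum !linear_sumlz /=; apply: eq_bigr => j _.
by rewrite tens_dot regZ dotZl reg_Lam mulr1 -haarE mulrC.
Qed.

End HopfAlgebra.

Lemma ctrmxK (C : numClosedFieldType) m n (M : 'M[C]_(m, n)) : M ^t* ^t* = M.
Proof. by apply/matrixP => i j; rewrite !mxE conjCK. Qed.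

Lemma ctrmxM (C : numClosedFieldType) m n p (M : 'M[C]_(m, n)) (N : 'M[C]_(n, p)) :
  (M *m N) ^t* = N ^t* *m M ^t*.
Proof. by rewrite trmx_mul map_mxM. Qed.

(** * Matrices over the C*-algebra and scalar matrices *)

Section StarMatrices.
Context {R : realType} {G : hopf_cstar R}.
Local Notation A := (Cred G).
Local Notation C := R[i].
Local Notation lift := (@lift_mx R G _ _).

Definition adjmx m n (X : 'M[A]_(m, n)) : 'M[A]_(n, m) := (conj_mx X)^T.

Lemma adjmxE m n (X : 'M[A]_(m, n)) i j : adjmx X i j = adj (X j i).
Proof. by rewrite !mxE. Qed.

Lemma adjmxM m n p (X : 'M[A]_(m, n)) (Y : 'M[A]_(n, p)) :
  adjmx (X *m Y) = adjmx Y *m adjmx X.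
Proof.
apply/matrixP => i j; rewrite adjmxE !mxE adj_sum; apply: eq_bigr => k _.
by rewrite adjM !adjmxE.
Qed.

Lemma adjmxK m n (X : 'M[A]_(m, n)) : adjmx (adjmx X) = X.
Proof. by apply/matrixP => i j; rewrite !adjmxE adjK. Qed.

Lemma adjmx0 m n : adjmx (0 : 'M[A]_(m, n)) = 0.
Proof. by apply/matrixP => i j; rewrite adjmxE !mxE adj0. Qed.

Lemma lift_mxE m n (M : 'M[C]_(m, n)) i j : lift_mx M i j = M i j *: (1 : A).
Proof. by rewrite mxE. Qed.

Lemma adjmx_lift m n (M : 'M[C]_(m, n)) : adjmx (lift_mx M) = lift (M ^t*).
Proof. by apply/matrixP => i j; rewrite adjmxE !lift_mxE !mxE adjZ adj1. Qed.

Lemma lift_mxM m n p (M : 'M[C]_(m, n)) (N : 'M[C]_(n, p)) :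
  lift_mx (M *m N) = lift_mx M *m lift_mx N :> 'M[A]_(m, p).
Proof. exact: map_mxM. Qed.

Lemma lift_mxD m n (M N : 'M[C]_(m, n)) :
  lift_mx (M + N) = lift_mx M + lift_mx N :> 'M[A]_(m, n).
Proof. exact: map_mxD. Qed.

Lemma lift_mxB m n (M N : 'M[C]_(m, n)) :
  lift_mx (M - N) = lift_mx M - lift_mx N :> 'M[A]_(m, n).
Proof. exact: map_mxB. Qed.

Lemma lift_mx0 m n : lift_mx (0 : 'M[C]_(m, n)) = 0 :> 'M[A]_(m, n).
Proof. exact: map_mx0. Qed.

Lemma lift_mx1 n : lift_mx (1%:M : 'M[C]_n) = 1%:M :> 'M[A]_n.
Proof. exact: map_mx1. Qed.

Lemma lift_mulE m n p (M : 'M[C]_(m, n)) (X : 'M[A]_(n, p)) i j :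
  (lift_mx M *m X) i j = \sum_k M i k *: X k j.
Proof. by rewrite mxE; apply: eq_bigr => k _; rewrite lift_mxE -scalerAl mul1r. Qed.

Lemma mul_liftE m n p (X : 'M[A]_(m, n)) (M : 'M[C]_(n, p)) i j :
  (X *m lift_mx M) i j = \sum_k M k j *: X i k.
Proof. by rewrite mxE; apply: eq_bigr => k _; rewrite lift_mxE -scalerAr mulr1. Qed.

(** Transposition reverses this product over a noncommutative algebra because one factor has scalar
    entries. *)
Lemma lift_mulmx_tr m n p (M : 'M[C]_(m, n)) (X : 'M[A]_(n, p)) :
  (lift_mx M *m X)^T = X^T *m lift_mx M^T.
Proof.
by apply/matrixP => i j; rewrite mxE lift_mulE mul_liftE; apply: eq_bigr => k _; rewrite !mxE.
Qed.

Lemma mulmx_lift_tr m n p (X : 'M[A]_(m, n)) (M : 'M[C]_(n, p)) :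
  (X *m lift_mx M)^T = lift_mx M^T *m X^T.
Proof.
by apply/matrixP => i j; rewrite mxE lift_mulE mul_liftE; apply: eq_bigr => k _; rewrite !mxE.
Qed.

Lemma conj_mxK m n (X : 'M[A]_(m, n)) : conj_mx (conj_mx X) = X.
Proof. by apply/matrixP => i j; rewrite !mxE adjK. Qed.

Lemma conj_lift_mul m n p (M : 'M[C]_(m, n)) (X : 'M[A]_(n, p)) :
  conj_mx (lift_mx M *m X) = lift_mx (map_mx Num.conj M) *m conj_mx X.
Proof.
apply/matrixP => i j; rewrite mxE !lift_mulE adj_sum; apply: eq_bigr => k _.
by rewrite adjZ !mxE.
Qed.

Lemma conj_mul_lift m n p (X : 'M[A]_(m, n)) (M : 'M[C]_(n, p)) :
  conj_mx (X *m lift_mx M) = conj_mx X *m lift_mx (map_mx Num.conj M).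
Proof.
apply/matrixP => i j; rewrite mxE !mul_liftE adj_sum; apply: eq_bigr => k _.
by rewrite adjZ !mxE.
Qed.

End StarMatrices.

(** * Compressions, tensor products and direct sums of corepresentations *)

Section Corepresentations.
Context {R : realType} {G : hopf_cstar R}.
Local Notation A := (Cred G).
Local Notation C := R[i].
Local Notation h := (@haar R G).
Local Notation "x \ox y" := (tens (l2l2 G) x y) (at level 40).
Local Notation lift := (@lift_mx R G _ _).

(** Unitarity is left out: conjugates and compressions satisfy this condition before anything is
    known about their inverses. *)
Definition corep n (u : 'M[A]_n) :=
  forall i j, coproduct (u i j) (fun k => u i k) (fun k => u k j).

(* The (i, j) entry of B_12 D_13. *)
Let leg_mul m n p (B : 'M[A]_(m, n)) (D : 'M[A]_(n, p)) i j x y :=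
  \sum_k (reg (B i k) x) \ox (reg (D k j) y).

Let leg_mul_lift m n q p (B : 'M[A]_(m, n)) (M : 'M[C]_(n, q)) (D : 'M[A]_(q, p)) i j x y :
  leg_mul (B *m lift_mx M) D i j x y = leg_mul B (lift_mx M *m D) i j x y.
Proof.
rewrite /leg_mul.
under eq_bigr do rewrite mul_liftE reg_sum linear_sumlz.
under [RHS]eq_bigr do rewrite lift_mulE reg_sum linear_sumr.
rewrite exchange_big /=; apply: eq_bigr => k _; apply: eq_bigr => l _.
by rewrite !regZ linearZl_LR linearZr_LR.
Qed.

(** The coproduct of X u Y is (X u)_12 (u Y)_13. By hypothesis Y X may be inserted after X u, and
    the scalar X then slides to the second leg, which gives (X u Y)_12 (X u Y)_13. *)
Lemma corep_compress m n (u : 'M[A]_n) (X : 'M[C]_(m, n)) (Y : 'M[C]_(n, m)) :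
  corep u -> lift X *m u *m lift (Y *m X) = lift X *m u ->
  corep (lift X *m u *m lift Y).
Proof.
move=> cu XuYX i j x y.
transitivity (leg_mul (lift X *m u) (u *m lift Y) i j x y); last first.
  by rewrite -{1}XuYX lift_mxM mulmxA leg_mul_lift !mulmxA.
rewrite mul_liftE Delta_sum.
under eq_bigr do rewrite DeltaZ lift_mulE Delta_sum.
rewrite /leg_mul.
under [RHS]eq_bigr do rewrite mul_liftE reg_sum linear_sumr.
rewrite [RHS]exchange_big /=; apply: eq_bigr => l _.
under [RHS]eq_bigr do rewrite regZ linearZr_LR lift_mulE reg_sum linear_sumlz /=.
rewrite -scaler_sumr exchange_big /=; congr (_ *: _); apply: eq_bigr => k _.
rewrite DeltaZ cu scaler_sumr; apply: eq_bigr => p _.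
by rewrite regZ linearZl_LR.
Qed.

Lemma corep_conj n (u : 'M[A]_n) : corep u -> corep (conj_mx u).
Proof.
move=> cu i j x y; rewrite mxE (coproduct_adj (cu i j)).
by apply: eq_bigr => k _; rewrite !mxE.
Qed.

Lemma unitary_corepP n (u : 'M[A]_n) :
  unitary_corep u <-> [/\ adjmx u *m u = 1%:M, u *m adjmx u = 1%:M & corep u].
Proof. by []. Qed.

Lemma unitary_corep_suml n (u : 'M[A]_n) i j : unitary_corep u ->
  \sum_k adj (u k i) * u k j = (i == j)%:R.
Proof.
move=> [/matrixP/(_ i j) + _ _]; rewrite !mxE => <-.
by apply: eq_bigr => k _; rewrite !mxE.
Qed.

Lemma unitary_corep_sumr n (u : 'M[A]_n) i j : unitary_corep u ->
  \sum_k u i k * adj (u j k) = (i == j)%:R.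
Proof.
move=> [_ /matrixP/(_ i j) + _]; rewrite !mxE => <-.
by apply: eq_bigr => k _; rewrite !mxE.
Qed.

Lemma corep_tens m n (u : 'M[A]_m) (v : 'M[A]_n) :
  corep u -> corep v -> corep (tensmx u v).
Proof.
move=> cu cv i j x y; rewrite mxE (coproductM (cu _ _) (cv _ _)).
rewrite (reindex (@mxtens_unindex m n)) /=; last first.
  by exists (@mxtens_index m n) => k _; rewrite ?mxtens_indexK ?mxtens_unindexK.
by apply: eq_bigr => k _; rewrite !mxE.
Qed.

Lemma sum_mxtens (V : nmodType) m n (f : 'I_(m * n) -> V) :
  \sum_k f k = \sum_i \sum_j f (mxtens_index (i, j)).
Proof.
rewrite pair_big (reindex (@mxtens_index m n)) /=.
  by apply: eq_bigr => -[].
by exists (@mxtens_unindex m n) => k _; rewrite ?mxtens_indexK ?mxtens_unindexK.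
Qed.

Lemma unitary_corep_tens m n (u : 'M[A]_m) (v : 'M[A]_n) :
  unitary_corep u -> unitary_corep v -> unitary_corep (tensmx u v).
Proof.
move=> uu uv; have [_ _ cu] := uu; have [_ _ cv] := uv.
split; last exact: corep_tens.
  apply/matrixP => i j; case: (mxtens_indexP i) => i1 i2; case: (mxtens_indexP j) => j1 j2.
  rewrite !mxE sum_mxtens exchange_big /= (can_eq (@mxtens_indexK m n)) xpair_eqE.
  (* Since [adj] reverses products, the two factors from u are adjacent here and contract first; in
     the other unitarity relation those from v do. *)
  transitivity (\sum_k adj (v k i2) * (\sum_l adj (u l i1) * u l j1) * v k j2).
    apply: eq_bigr => k _; rewrite mulr_sumr mulr_suml; apply: eq_bigr => l _.
    by rewrite !mxE !mxtens_indexK /= adjM !mulrA.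
  rewrite (unitary_corep_suml _ _ uu).
  case: eqP => _ /=; last by rewrite big1 // => k _; rewrite mulr0 mul0r.
  by rewrite -(unitary_corep_suml _ _ uv); apply: eq_bigr => k _; rewrite mulr1.
apply/matrixP => i j; case: (mxtens_indexP i) => i1 i2; case: (mxtens_indexP j) => j1 j2.
rewrite !mxE sum_mxtens (can_eq (@mxtens_indexK m n)) xpair_eqE.
transitivity (\sum_k u i1 k * (\sum_l v i2 l * adj (v j2 l)) * adj (u j1 k)).
  apply: eq_bigr => k _; rewrite mulr_sumr mulr_suml; apply: eq_bigr => l _.
  by rewrite !mxE !mxtens_indexK /= adjM !mulrA.
rewrite (unitary_corep_sumr _ _ uv) andbC.
case: eqP => _ /=; last by rewrite big1 // => k _; rewrite mulr0 mul0r.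
by rewrite -(unitary_corep_sumr _ _ uu); apply: eq_bigr => k _; rewrite mulr1.
Qed.

(** Direct sums make the matrix coefficients a linear space, since each coefficient is taken from a
    single corepresentation. *)
Lemma unitary_corep_block m n (u : 'M[A]_m) (v : 'M[A]_n) :
  unitary_corep u -> unitary_corep v -> unitary_corep (block_mx u 0 0 v).
Proof.
have conj0 p q : conj_mx (0 : 'M[A]_(p, q)) = 0.
  by apply/matrixP => i j; rewrite !mxE adj0.
have z0 p q i j : (0 : 'M[A]_(p, q)) i j = 0 by rewrite mxE.
move=> [u1 u2 cu] [v1 v2 cv]; rewrite /unitary_corep /conj_mx map_block_mx.
rewrite -!/(conj_mx _) !conj0 tr_block_mx !trmx0 !mulmx_block.
rewrite !mulmx0 !mul0mx !addr0 !add0r u1 u2 v1 v2 -scalar_mx_block; split=> // i j x y.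
rewrite big_split_ord /=.
case: (split_ordP i) => i' ->; case: (split_ordP j) => j' ->; rewrite ?block_mxEul ?block_mxEur ?block_mxEdl ?block_mxEdr.
- rewrite cu [X in _ + X]big1 ?addr0; last first.
    by move=> k _; rewrite block_mxEur z0 reg0 linear0l.
  by apply: eq_bigr => k _; rewrite !block_mxEul.
- rewrite z0 Delta0 !big1 ?addr0 // => k _.
    by rewrite block_mxEur z0 reg0 linear0l.
  by rewrite block_mxEur z0 reg0 linear0r.
- rewrite z0 Delta0 !big1 ?addr0 // => k _.
    by rewrite block_mxEdl z0 reg0 linear0r.
  by rewrite block_mxEdl z0 reg0 linear0l.
- rewrite cv [X in X + _]big1 ?add0r; last first.
    by move=> k _; rewrite block_mxEdl z0 reg0 linear0l.
  by apply: eq_bigr => k _; rewrite !block_mxEdr.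
Qed.

Lemma matrix_coefficients_comb (z : C) a b : matrix_coefficients G a ->
  matrix_coefficients G b -> matrix_coefficients G (z *: a + b).
Proof.
move=> [m [u [c [uu ->]]]] [n [v [d [uv ->]]]].
exists (m + n)%N, (block_mx u 0 0 v), (block_mx (z *: c) 0 0 d).
split; first exact: unitary_corep_block.
rewrite big_split_ord /=; congr (_ + _).
  rewrite scaler_sumr; apply: eq_bigr => i _; rewrite big_split_ord /= [X in _ + X]big1.
    rewrite addr0 scaler_sumr; apply: eq_bigr => j _.
    by rewrite !block_mxEul mxE scalerA.
  by move=> j _; rewrite !block_mxEur !mxE scaler0.
apply: eq_bigr => i _; rewrite big_split_ord /= [X in X + _]big1 ?add0r.
  by apply: eq_bigr => j _; rewrite !block_mxEdr.
by move=> j _; rewrite !block_mxEdl !mxE scaler0.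
Qed.

Lemma matrix_coefficients0 : matrix_coefficients G 0.
Proof.
exists 0%N, 0, 0; split; last by rewrite big_ord0.
by split; rewrite ?[LHS]flatmx0 ?[RHS]flatmx0 // => -[].
Qed.

Lemma matrix_coefficientsZ (z : C) a :
  matrix_coefficients G a -> matrix_coefficients G (z *: a).
Proof.
by move=> ha; rewrite -[_ *: _]addr0; apply: matrix_coefficients_comb;
  last exact: matrix_coefficients0.
Qed.

Lemma matrix_coefficient_entry n (u : 'M[A]_n) i j :
  unitary_corep u -> matrix_coefficients G (u i j).
Proof.
move=> uu; exists n, u, (delta_mx i j); split=> //.
rewrite (bigD1 i) //= (bigD1 j) //= !mxE !eqxx scale1r !big1 ?addr0 //.
  by move=> k /negPf ki; rewrite big1 // => l _; rewrite mxE ki scale0r.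
by move=> k /negPf kj; rewrite mxE kj andbF scale0r.
Qed.

Lemma matrix_coefficients_sum (I : Type) (r : seq I) (z : I -> C) (f : I -> A) :
  (forall i, matrix_coefficients G (f i)) ->
  matrix_coefficients G (\sum_(i <- r) z i *: f i).
Proof.
move=> hf; elim: r => [|i r IH]; first by rewrite big_nil; exact: matrix_coefficients0.
by rewrite big_cons; exact: matrix_coefficients_comb.
Qed.

Lemma matrix_coefficientsM a b : matrix_coefficients G a ->
  matrix_coefficients G b -> matrix_coefficients G (a * b).
Proof.
move=> [m [u [c [uu ->]]]] [n [v [d [uv ->]]]].
have one (I : Type) (r : seq I) (f : I -> A) : \sum_(i <- r) f i = \sum_(i <- r) 1 *: f i.
  by apply: eq_bigr => i _; rewrite scale1r.
rewrite mulr_suml one; apply: matrix_coefficients_sum => i.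
rewrite mulr_suml one; apply: matrix_coefficients_sum => j.
rewrite mulr_sumr one; apply: matrix_coefficients_sum => k.
rewrite mulr_sumr one; apply: matrix_coefficients_sum => l.
rewrite -scalerAl -scalerAr; do 2!apply: matrix_coefficientsZ.
by rewrite -tensmxE; apply: matrix_coefficient_entry; exact: unitary_corep_tens.
Qed.

End Corepresentations.

(** Gram-Schmidt on a row basis of the transpose; W is an isometry onto the column space of V. *)
Lemma orthonormal_range (C : numClosedFieldType) n k (V : 'M[C]_(n, k)) :
  exists (W : 'M[C]_(n, \rank V)) X Y,
    [/\ W = V *m X, V = W *m Y & W ^t* *m W = 1%:M].
Proof.
rewrite -mxrank_tr; pose B := row_base V^T; pose S : 'M[C]_(\rank V^T, n) := schmidt B.
have rn : (\rank V^T <= n)%N by rewrite rank_leq_col.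
have Su : S *m S ^t* = 1%:M by apply/unitarymxP; exact: schmidt_unitarymx.
have SV : (S :=: V^T)%MS.
  apply: eqmx_trans (eq_row_base V^T).
  by apply: eqmx_schmidt_free; exact: row_base_free.
have /submxP[X SX] : (S <= V^T)%MS by rewrite SV.
have /submxP[Y VY] : (V^T <= S)%MS by rewrite SV.
exists S^T, X^T, Y^T; split.
- by apply: trmx_inj; rewrite trmx_mul !trmxK.
- by apply: trmx_inj; rewrite trmx_mul !trmxK.
- by apply: trmx_inj; rewrite trmx_mul trmx1 !trmxK map_trmx Su.
Qed.

(** * Complete reducibility *)

Section CompleteReducibility.
Context {R : realType} {G : discrete_quantum_group R}.
Local Notation A := (Cred G).
Local Notation C := R[i].
Local Notation h := (@haar R G).
Local Notation lift := (@lift_mx R G _ _).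

Lemma matrix_coefficients_density (f : {scalar A}) (K : C) :
  (forall a, `|f a| <= K * (cnorm a)%:C) ->
  (forall n (u : 'M[A]_n) i j, unitary_corep u -> f (u i j) = 0) ->
  forall a, f a = 0.
Proof.
move=> fK fu a; apply/eqP; apply/negPn/negP => fa0.
have n0 : 0 < `|f a| by rewrite normr_gt0.
have Kr : (complex.Re `|K|)%:C = `|K| by apply: RRe_real.
have fr : (complex.Re `|f a|)%:C = `|f a| by apply: RRe_real.
have K1 : 0 < complex.Re `|K| + 1.
  by rewrite ltr_wpDl // -lecR Kr; exact: normr_ge0.
have fr0 : 0 < complex.Re `|f a| by rewrite -ltcR fr.
have [b [n [u [c [uu ->]]]] hb] := dqg_dense a (divr_gt0 fr0 K1).
have fb : f (\sum_i \sum_j c i j *: u i j) = 0.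
  rewrite linear_sum big1 // => i _; rewrite linear_sum big1 // => j _.
  by rewrite linearZ /= fu // mulr0.
have := fK (a - \sum_i \sum_j c i j *: u i j).
rewrite linearB /= fb subr0 => hf.
have : `|f a| <= (complex.Re `|K| + 1)%:C * (cnorm (a - \sum_i \sum_j c i j *: u i j))%:C.
  have c0 : 0 <= (cnorm (a - \sum_i \sum_j c i j *: u i j))%:C :> C.
    by apply: le_trans (norm_Lam _).
  apply: (le_trans hf); apply: (@le_trans _ _ (`|K| * (cnorm (a - \sum_i \sum_j c i j *: u i j))%:C)).
    have hn := le_trans (normr_ge0 _) hf.
    by rewrite -[X in _ <= `|K| * X]ger0_norm // -normrM ger0_norm.
  by rewrite ler_wpM2r // rmorphD /= Kr lerDl ler01.
rewrite -rmorphM -fr lecR; rewrite ltr_pdivlMr // mulrC in hb.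
by move=> /le_lt_trans /(_ hb); rewrite ltxx.
Qed.

(** Strong invariance of the Haar state. Right invariance turns h(u_pj v_kl) 1 into sum_rq h(u_rj
    v_ql) u_pr v_kq; multiplying on the left by u_pi^* and summing over p leaves r = i by
    unitarity. *)
Lemma haar_slice n m (u : 'M[A]_n) (v : 'M[A]_m) i j k l :
  unitary_corep u -> corep v ->
  \sum_p h (u p j * v k l) *: adj (u p i) = \sum_q h (u i j * v q l) *: v k q.
Proof.
move=> uu cv; have [_ _ cu] := uu.
transitivity (\sum_p adj (u p i) * \sum_(rq : 'I_n * 'I_m)
    h (u rq.1 j * v rq.2 l) *: (u p rq.1 * v k rq.2)).
  apply: eq_bigr => p _; rewrite (haar_right (coproductM (cu p j) (cv k l))).
  by rewrite -scalerAr mulr1.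
under eq_bigr do rewrite mulr_sumr.
rewrite exchange_big /= -(pair_big xpredT xpredT (fun r q =>
  \sum_p adj (u p i) * (h (u r j * v q l) *: (u p r * v k q)))) /=.
rewrite (bigD1 i) //= [X in _ + X]big1 ?addr0 => [|r ri].
  apply: eq_bigr => q _; under eq_bigr do rewrite -scalerAr mulrA.
  by rewrite -scaler_sumr -mulr_suml unitary_corep_suml // eqxx mul1r.
rewrite big1 // => q _; under eq_bigr do rewrite -scalerAr mulrA.
by rewrite -scaler_sumr -mulr_suml unitary_corep_suml // eq_sym (negPf ri) mul0r scaler0.
Qed.

(* Invariance of the Haar state under the antipode, (id (x) S) u = u^*. *)
Lemma haar_antipode n m (u : 'M[A]_n) (v : 'M[A]_m) i j r l :
  unitary_corep u -> unitary_corep v ->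
  Num.conj (h (u i j * v r l)) = h (u j i * v l r).
Proof.
move=> uu uv; have [_ _ cv] := uv.
(* The matrix M with rows (i, r), columns (j, l) and entries h(u_ij v_rl) satisfies M = M^* M, hence
   is self-adjoint. *)
have key i' j' r' l' : h (u i' j' * v r' l') =
    \sum_k \sum_p Num.conj (h (u p i' * v k r')) * h (u p j' * v k l').
  transitivity (\sum_k h (adj (v k r') * \sum_q h (u i' j' * v q l') *: v k q)).
    under eq_bigr do rewrite mulr_sumr linear_sum.
    rewrite exchange_big (bigD1 r') //= [X in _ + X]big1 ?addr0 => [|q qr].
      under eq_bigr do rewrite -scalerAr linearZ.
      by rewrite /= -mulr_sumr -linear_sum unitary_corep_suml // eqxx haar1 mulr1.
    under eq_bigr do rewrite -scalerAr linearZ.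
    by rewrite /= -mulr_sumr -linear_sum unitary_corep_suml // eq_sym (negPf qr) linear0 mulr0.
  apply: eq_bigr => k _; rewrite -haar_slice // mulr_sumr linear_sum; apply: eq_bigr => p _.
  by rewrite -scalerAr linearZ /= -haar_adj adjM mulrC.
rewrite key rmorph_sum /= [RHS]key; apply: eq_bigr => k _; rewrite rmorph_sum.
by apply: eq_bigr => p _; rewrite rmorphM /= conjCK mulrC.
Qed.

(* With b(a) = (id (x) h)(u (1 (x) a)) and Q = 1 - P, we have Q b(a) P = 0; by
   [haar_antipode] the b(a) form a self-adjoint set, so they commute with P.  By
   [haar_slice], Q u^* P b(a) = 0 for all a, and a = u_lk^* gives Q u^* P = 0. *)
Lemma maschke n (u : 'M[A]_n) (P : 'M[C]_n) : unitary_corep u ->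
  P ^t* = P -> P *m P = P -> u *m lift P = lift P *m u *m lift P ->
  lift P *m u = u *m lift P.
Proof.
move=> uu Pa PP uP; have [u1 u2 cu] := uu.
pose Q := 1%:M - P; have Qa : Q ^t* = Q.
  by rewrite /Q linearB /= trmx1 map_mxB map_mx1 Pa.
have QuP : lift Q *m u *m lift P = 0.
  by rewrite /Q lift_mxB lift_mx1 !mulmxBl mul1mx uP subrr.
pose b a : 'M[C]_n := \matrix_(i, j) h (u i j * a).
have bE (X Y : 'M[C]_n) a i j : (X *m b a *m Y) i j = h ((lift X *m u *m lift Y) i j * a).
  rewrite mul_liftE mulr_suml linear_sum mxE; apply: eq_bigr => k _.
  rewrite -scalerAl linearZ /= mulrC lift_mulE mulr_suml linear_sum !mxE; congr (_ * _).
  by apply: eq_bigr => l _; rewrite !mxE -scalerAl linearZ.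
have QbP a : Q *m b a *m P = 0.
  by apply/matrixP => i j; rewrite bE QuP !mxE mul0r linear0.
have PbQ m (v : 'M[A]_m) k l : unitary_corep v -> P *m b (v k l) *m Q = 0.
  move=> uv; have ba : b (v k l) = (b (v l k)) ^t*.
    by apply/matrixP => i j; rewrite !mxE -(haar_antipode _ _ _ _ uu uv).
  rewrite ba -[P]Pa -[Q in LHS]Qa -!ctrmxM mulmxA QbP.
  by apply/matrixP => i j; rewrite !mxE conjC0.
have QuaP m (v : 'M[A]_m) k l : unitary_corep v ->
    lift Q *m adjmx u *m lift (b (v k l)) *m lift P = 0.
  move=> uv; have [_ _ cv] := uv; apply/matrixP => i j.
  rewrite mul_liftE [RHS]mxE.
  transitivity (\sum_s \sum_r \sum_q ((P s j * Q i r * b (v q l) r s) *: v k q)).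
    apply: eq_bigr => s _; rewrite -mulmxA lift_mulE scaler_sumr.
    apply: eq_bigr => r _; rewrite mul_liftE.
    under eq_bigr do rewrite mxE adjmxE.
    rewrite haar_slice // !scaler_sumr; apply: eq_bigr => q _.
    by rewrite !scalerA [b _ r s]mxE.
  rewrite exchange_big /=; under eq_bigr do rewrite exchange_big /=.
  rewrite exchange_big big1 //= => q _; rewrite exchange_big /=.
  transitivity ((Q *m b (v q l) *m P) i j *: v k q); last by rewrite QbP mxE scale0r.
  rewrite mxE scaler_suml; apply: eq_bigr => s _; rewrite mxE mulr_suml scaler_suml.
  by apply: eq_bigr => r _; congr (_ *: _); rewrite -mulrA mulrC.
pose X := lift Q *m adjmx u *m lift P.
have Xb m (v : 'M[A]_m) k l : unitary_corep v -> X *m lift (b (v k l)) = 0.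
  move=> uv; have Pb : P *m b (v k l) = b (v k l) *m P.
    transitivity (P *m b (v k l) *m P).
      rewrite -[LHS]mulmx1 -(subrK P 1%:M) mulmxDr PbQ // add0r //.
    rewrite -[RHS]mul1mx -[in RHS](subrK P 1%:M) mulmxDl mulmxA.
    by rewrite QbP add0r mulmxA.
  by rewrite /X -mulmxA -lift_mxM Pb lift_mxM mulmxA QuaP.
have X0 : X = 0.
  apply/matrixP => i l; rewrite [RHS]mxE; apply: reg_dot_inj => x y.
  rewrite reg0 linear0l.
  (* [Xb] covers only coefficients of unitary corepresentations, and [adj (u l k)] is not yet known
     to be one. Pairing with x and y gives a bounded functional of a, which vanishes everywhere by
     density. *)
  have fz a k : \sum_j h (u j k * a) * dot (reg (X i j) x) y = 0.
    pose f a := \sum_j h (u j k * a) * dot (reg (X i j) x) y.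
    have fl : scalar f.
      move=> z c d; rewrite /f mulr_sumr -big_split; apply: eq_bigr => j _ /=.
      by rewrite mulrDr -scalerAr linearP /= mulrDl mulrA.
    pose F : {scalar A} := HB.pack f (GRing.isLinear.Build _ _ _ _ f fl).
    apply: (@matrix_coefficients_density F
      (\sum_j (cnorm (u j k))%:C * `|dot (reg (X i j) x) y|)) => [c|m v p q uv].
      rewrite /F /= /f mulr_suml; apply: (le_trans (ler_norm_sum _ _ _)).
      apply: ler_sum => j _; rewrite normrM mulrAC ler_wpM2r //.
      by apply: (le_trans (norm_haar _)); rewrite -rmorphM lecR cnormM.
    have /matrixP/(_ i k) := Xb m v p q uv; rewrite mul_liftE !mxE => h0.
    transitivity (dot (reg (\sum_j b (v p q) j k *: X i j) x) y); last first.
      by rewrite h0 reg0 linear0l.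
    rewrite reg_sum linear_sumlz /=; apply: eq_bigr => j _.
    by rewrite regZ dotZl [b _ _ _]mxE.
  transitivity (\sum_k \sum_j h (u j k * adj (u l k)) * dot (reg (X i j) x) y); last first.
    by rewrite big1 // => k _; rewrite fz.
  rewrite exchange_big (bigD1 l) //= [X in _ + X]big1 ?addr0 => [|j jl].
    by rewrite -mulr_suml -linear_sum unitary_corep_sumr // eqxx haar1 mul1r.
  by rewrite -mulr_suml -linear_sum unitary_corep_sumr // (negPf jl) linear0 mul0r.
have : adjmx X = 0 by rewrite X0 adjmx0.
rewrite /X !adjmxM !adjmx_lift Pa Qa adjmxK mulmxA /Q lift_mxB lift_mx1 mulmxBr mulmx1.
by move/eqP; rewrite subr_eq0 uP => /eqP.
Qed.

Lemma unitary_corep_compress n m (u : 'M[A]_n) (W : 'M[C]_(n, m)) :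
  unitary_corep u -> W ^t* *m W = 1%:M ->
  lift (W *m W ^t*) *m u = u *m lift (W *m W ^t*) ->
  unitary_corep (lift (W ^t*) *m u *m lift W) /\
  u *m lift W = lift W *m (lift (W ^t*) *m u *m lift W).
Proof.
move=> uu WW Pu; have [u1 u2 cu] := uu.
have uW : u *m lift W = lift W *m (lift (W ^t*) *m u *m lift W).
  by rewrite !mulmxA -lift_mxM Pu -mulmxA -lift_mxM -mulmxA WW mulmx1.
have Wu : lift (W ^t*) *m u = lift (W ^t*) *m u *m lift (W *m W ^t*).
  by rewrite -mulmxA -Pu mulmxA -lift_mxM mulmxA WW mul1mx.
split=> //; apply/unitary_corepP; move: u1 u2; rewrite -/(adjmx u) => u1 u2.
rewrite !adjmxM !adjmx_lift ctrmxK; split; last exact: corep_compress.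
  have uW' : lift W *m (lift (W ^t*) *m (u *m lift W)) = u *m lift W.
    by rewrite [RHS]uW !mulmxA.
  by rewrite -!mulmxA uW' (mulmxA (adjmx u)) u1 mul1mx -lift_mxM WW lift_mx1.
have Wu' : lift (W ^t*) *m (u *m (lift W *m lift (W ^t*))) = lift (W ^t*) *m u.
  by rewrite [RHS]Wu lift_mxM !mulmxA.
rewrite !mulmxA -(mulmxA _ (lift W) (lift (W ^t*))) -(mulmxA _ u) Wu'.
by rewrite -(mulmxA _ u) u2 mulmx1 -lift_mxM WW lift_mx1.
Qed.

(** By [maschke] the complement of a proper nonzero invariant subspace is invariant as well; W1 and
    W2 are isometries onto the two, each of smaller dimension. *)
Lemma corep_split n (u : 'M[A]_n) : unitary_corep u -> (0 < n)%N ->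
  ~ irreducible_corep u ->
  exists r1 r2 (W1 : 'M[C]_(n, r1)) (W2 : 'M[C]_(n, r2)),
    [/\ (r1 < n)%N /\ (r2 < n)%N, W1 ^t* *m W1 = 1%:M /\ W2 ^t* *m W2 = 1%:M,
        W1 *m W1 ^t* + W2 *m W2 ^t* = 1%:M,
        lift (W1 *m W1 ^t*) *m u = u *m lift (W1 *m W1 ^t*)
      & lift (W2 *m W2 ^t*) *m u = u *m lift (W2 *m W2 ^t*)].
Proof.
move=> uu n0 nirr.
have [k [V [w [uV V0 Vn]]]] : exists k (V : 'M[C]_(n, k)) (w : 'M[A]_k),
    [/\ u *m lift V = lift V *m w, \rank V <> 0%N & \rank V <> n].
  apply: contrapT => hne; apply: nirr; split=> // k V w uV.
  apply: contrapT => hV; apply: hne; exists k, V, w; split=> // hr; apply: hV;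
    by [left|right].
have [W [X [Y [WX VY WW]]]] := orthonormal_range V.
pose P := W *m W ^t*; pose Q := 1%:M - P.
have Pa : P ^t* = P by rewrite /P ctrmxM ctrmxK.
have PP : P *m P = P by rewrite /P mulmxA -(mulmxA W) WW mulmx1.
have Qa : Q ^t* = Q.
  by rewrite /Q linearB /= trmx1 map_mxB map_mx1 Pa.
have uP : u *m lift P = lift P *m u *m lift P.
  have uW : u *m lift W = lift W *m (lift Y *m w *m lift X).
    have lW : lift W = lift V *m lift X by rewrite -lift_mxM -WX.
    have lV : lift V = lift W *m lift Y by rewrite -lift_mxM -VY.
    by rewrite {1}lW mulmxA uV lV !mulmxA.
  rewrite {1 3}/P lift_mxM !mulmxA -(mulmxA _ u) uW (mulmxA _ (lift W)).
  by rewrite -(mulmxA (lift W) _ (lift W)) -lift_mxM WW lift_mx1 mulmx1.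
have Pu := maschke uu Pa PP uP.
have [W2 [X2 [Y2 [WX2 QY WW2]]]] := orthonormal_range Q.
have QQ : Q *m Q = Q.
  by rewrite /Q mulmxBl mul1mx !mulmxBr mulmx1 PP subrr subr0.
have W2Q : W2 *m W2 ^t* = Q.
  (* W2 W2^* and Q are self-adjoint projections with the same range, so each absorbs the other; the
     adjoint of [h1] compared with [h2] gives equality. *)
  have h1 : W2 *m W2 ^t* *m Q = Q.
    have : W2 *m W2 ^t* *m (W2 *m Y2) = W2 *m Y2.
      by rewrite mulmxA -(mulmxA W2) WW2 mulmx1.
    by rewrite -QY.
  have h2 : Q *m (W2 *m W2 ^t*) = W2 *m W2 ^t*.
    have : Q *m (Q *m X2 *m W2 ^t*) = Q *m X2 *m W2 ^t* by rewrite !mulmxA QQ.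
    by rewrite -WX2.
  have h1' : Q *m (W2 *m W2 ^t*) = Q.
    have := congr1 (fun X : 'M[C]_n => map_mx Num.conj X^T) h1.
    by rewrite !ctrmxM ctrmxK Qa.
  by rewrite -h2 h1'.
have QW : Q *m W = 0.
  by rewrite /Q mulmxBl mul1mx /P -mulmxA WW mulmx1 subrr.
exists (\rank V), (\rank Q), W, W2; split=> //.
- split; first by rewrite ltn_neqAle rank_leq_row andbT; apply/eqP.
  rewrite ltn_neqAle rank_leq_row andbT; apply/eqP => Qn.
  have Qu : Q \in unitmx by rewrite -row_full_unit /row_full Qn.
  have W0 : W = 0 by rewrite -(mulKmx Qu W) QW mulmx0.
  by apply: V0; rewrite VY W0 mul0mx mxrank0.
- by rewrite W2Q addrC subrK.
- by rewrite W2Q /Q lift_mxB lift_mx1 mulmxBl mulmxBr mul1mx mulmx1 Pu.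
Qed.

End CompleteReducibility.

(** * Schur orthogonality and conjugates *)

Section Intertwiners.
Context {R : realType} {G : hopf_cstar R}.
Local Notation A := (Cred G).
Local Notation C := R[i].
Local Notation lift := (@lift_mx R G _ _).

(** The kernel of T is invariant under u. The target v is arbitrary, so that a tensor product may be
    taken for it in [subcorep_frobenius]. *)
Lemma schur_injective m n (u : 'M[A]_m) (v : 'M[A]_n) (T : 'M[C]_(n, m)) :
  irreducible_corep u -> intertwiner u v T -> T = 0 \/ \rank T = m.
Proof.
move=> [m0 iu] Tuv.
(* The range of K is the kernel of T. *)
pose Y := pinvmx T; pose K := 1%:M - Y *m T.
have TYT : T *m Y *m T = T by rewrite /Y mulmxKpV.
have TK : T *m K = 0 by rewrite /K mulmxBr mulmx1 mulmxA TYT subrr.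
have uK : u *m lift K = lift K *m (u *m lift K).
  have TK' : lift T *m lift K = 0 by rewrite -lift_mxM TK lift_mx0.
  have KE : lift K = 1%:M - lift Y *m lift T by rewrite lift_mxB lift_mx1 lift_mxM.
  rewrite {2}KE mulmxBl mul1mx -mulmxA (mulmxA (lift T)).
  by rewrite Tuv -(mulmxA v) TK' !mulmx0 subr0.
case: (iu _ _ _ uK) => [/eqP|rK].
  rewrite mxrank_eq0 /K subr_eq0 => /eqP YT; right.
  apply/eqP; rewrite eqn_leq rank_leq_col /=.
  by rewrite -{1}(mxrank1 C m) YT mxrankM_maxr.
left; have Ku : K \in unitmx by rewrite -row_full_unit /row_full rK.
by rewrite -(mulmxK Ku T) TK mul0mx.
Qed.

Lemma schur m n (u : 'M[A]_m) (v : 'M[A]_n) (T : 'M[C]_(n, m)) :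
  irreducible_corep u -> irreducible_corep v -> intertwiner u v T ->
  T = 0 \/ (\rank T = m /\ \rank T = n).
Proof.
move=> iu [n0 iv] Tuv; have [->|rm] := schur_injective iu Tuv; first by left.
have [/eqP|rn] := iv _ T u (esym Tuv); last by right.
by rewrite mxrank_eq0 => /eqP; left.
Qed.

Lemma schur_scalar n (u : 'M[A]_n) (T : 'M[C]_n) :
  irreducible_corep u -> intertwiner u u T -> exists z : C, T = z%:M.
Proof.
move=> iu Tu; have [n0 _] := iu.
have [z /eigenvalueP[x xT x0]] := eigenvalue_closed T n0.
exists z; have : intertwiner u u (T - z%:M).
  rewrite /intertwiner lift_mxB mulmxBl mulmxBr Tu; congr (_ - _).
  apply/matrixP => i j; rewrite lift_mulE mul_liftE.
  rewrite (bigD1 i) //= big1 ?addr0 => [|k ki]; last first.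
    by rewrite mxE eq_sym (negPf ki) scale0r.
  rewrite (bigD1 j) //= big1 ?addr0 => [|k ki]; last by rewrite mxE (negPf ki) scale0r.
  by rewrite !mxE !eqxx.
case/(schur iu iu) => [/eqP|[rn _]]; first by rewrite subr_eq0 => /eqP.
have Tz : T - z%:M \in unitmx by rewrite -row_full_unit /row_full rn.
case/negP: x0; rewrite -(mulmxK Tz x) mulmxBr xT mul_mx_scalar subrr mul0mx.
exact: eqxx.
Qed.

Lemma intertwiner_inv m n (u : 'M[A]_m) (v : 'M[A]_n) T T' :
  intertwiner u v T -> T' *m T = 1%:M -> T *m T' = 1%:M -> intertwiner v u T'.
Proof.
move=> Tuv T'T TT'; rewrite /intertwiner.
rewrite -[RHS]mul1mx -lift_mx1 -T'T lift_mxM -mulmxA (mulmxA (lift T)) Tuv.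
by rewrite -(mulmxA v) -lift_mxM TT' lift_mx1 mulmx1.
Qed.

Lemma intertwiner_comp m n p (u : 'M[A]_m) (v : 'M[A]_n) (w : 'M[A]_p) T U :
  intertwiner u v T -> intertwiner v w U -> intertwiner u w (U *m T).
Proof.
by move=> Tuv Uvw; rewrite /intertwiner lift_mxM -mulmxA Tuv mulmxA Uvw mulmxA.
Qed.

Lemma intertwiner_adj m n (u : 'M[A]_m) (v : 'M[A]_n) T :
  unitary_corep u -> unitary_corep v -> intertwiner u v T -> intertwiner v u (T ^t*).
Proof.
move=> [u1 u2 _] [v1 v2 _] Tuv; rewrite /intertwiner.
have := congr1 (@adjmx R G _ _) Tuv; rewrite !adjmxM !adjmx_lift => h.
have : u *m (adjmx u *m lift (T ^t*)) *m v = u *m (lift (T ^t*) *m adjmx v) *m v.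
  by rewrite h.
by rewrite !mulmxA [u *m adjmx u]u2 mul1mx -(mulmxA _ (adjmx v)) [adjmx v *m v]v1 mulmx1.
Qed.

Lemma corep_equiv_sym m n (u : 'M[A]_m) (v : 'M[A]_n) :
  corep_equiv u v -> corep_equiv v u.
Proof.
by move=> [T [T' [h h1 h2]]]; exists T', T; split=> //; exact: intertwiner_inv h h1 h2.
Qed.

Lemma corep_equiv_trans m n p (u : 'M[A]_m) (v : 'M[A]_n) (w : 'M[A]_p) :
  corep_equiv u v -> corep_equiv v w -> corep_equiv u w.
Proof.
move=> [T [T' [h h1 h2]]] [U [U' [k k1 k2]]]; exists (U *m T), (T' *m U'); split.
- exact: intertwiner_comp h k.
- by rewrite mulmxA -(mulmxA T') k1 mulmx1 h1.
- by rewrite mulmxA -(mulmxA U) h2 mulmx1 k2.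
Qed.

Lemma corep_equiv_subcorep m n (u : 'M[A]_m) (v : 'M[A]_n) :
  corep_equiv u v -> subcorep u v.
Proof.
move=> [T [T' [h h1 h2]]]; exists T => //; apply/eqP.
by rewrite eqn_leq rank_leq_col -{1}(mxrank1 C m) -h1 mxrankM_maxr.
Qed.

End Intertwiners.

Section Orthogonality.
Context {R : realType} {G : hopf_cstar R}.
Local Notation A := (Cred G).
Local Notation C := R[i].
Local Notation h := (@haar R G).
Local Notation lift := (@lift_mx R G _ _).

(** The matrix T is the Haar average of v^* E_ki u, where E_ki is a matrix unit. Left invariance
    gives v^* T u = T, and unitarity of v turns this into T u = v T. *)
Lemma haar_intertwiner m n (u : 'M[A]_m) (v : 'M[A]_n) k i :
  unitary_corep u -> unitary_corep v ->
  intertwiner u v (\matrix_(j, l) h (adj (v k j) * u i l)).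
Proof.
move=> uu uv; have [_ _ cu] := uu; have [_ v2 cv] := uv.
set T := \matrix_(j, l) _; rewrite /intertwiner.
suff vTu : adjmx v *m (lift T *m u) = lift T.
  by rewrite -[LHS]mul1mx -v2 -mulmxA -/(adjmx v) vTu.
apply/matrixP => j l; rewrite lift_mxE [T j l]mxE.
rewrite -(haar_left (coproductM (coproduct_adj (cv k j)) (cu i l))).
rewrite mxE (eq_bigr (fun p => \sum_q h (adj (v k p) * u i q) *: (adj (v p j) * u q l))).
  by rewrite pair_big.
move=> p _; rewrite adjmxE lift_mulE mulr_sumr; apply: eq_bigr => q _.
by rewrite -scalerAr mxE.
Qed.

(** Here the columns j and l are fixed, and right invariance gives conj(u) N u^T = N. The modular
    relation says that u^T, conjugated by F^T, is the inverse of conj(u); hence N F^T commutes with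
    conj(u), and entrywise adjoints give an intertwiner of u. *)
Lemma haar_intertwiner_conj n (u : 'M[A]_n) (F : 'M[C]_n) j l :
  unitary_corep u -> F \in unitmx ->
  contragredient (conj_mx u) (lift F *m u *m lift (invmx F)) ->
  intertwiner u u (map_mx Num.conj ((\matrix_(k, i) h (adj (u k j) * u i l)) *m F^T)).
Proof.
move=> uu Fu [c1 c2]; have [_ _ cu] := uu; set N := \matrix_(k, i) _.
set w := (lift F *m u *m lift (invmx F))^T in c1 c2.
have wE : w = lift (invmx F)^T *m u^T *m lift F^T.
  by rewrite /w mulmx_lift_tr lift_mulmx_tr mulmxA.
have uNu : conj_mx u *m lift N *m u^T = lift N.
  apply/matrixP => k i; rewrite lift_mxE [N k i]mxE.
  rewrite -(haar_right (coproductM (coproduct_adj (cu k j)) (cu i l))).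
  rewrite mxE; under eq_bigr do rewrite mul_liftE mulr_suml.
  rewrite exchange_big pair_big /=; apply: eq_bigr => pq _.
  by rewrite !mxE -scalerAl.
have FT : lift F^T *m lift (invmx F)^T = 1%:M.
  by rewrite -lift_mxM -trmx_mul mulVmx // trmx1 lift_mx1.
have FT' : lift (invmx F)^T *m lift F^T = 1%:M.
  by rewrite -lift_mxM -trmx_mul mulmxV // trmx1 lift_mx1.
have uT : u^T = lift F^T *m w *m lift (invmx F)^T.
  by rewrite wE !mulmxA FT mul1mx -mulmxA FT mulmx1.
have : conj_mx u *m lift (N *m F^T) = lift (N *m F^T) *m conj_mx u.
  rewrite lift_mxM -[in RHS]uNu uT !mulmxA -(mulmxA _ (lift (invmx F)^T)) FT' mulmx1.
  by rewrite -(mulmxA _ w) c2 mulmx1.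
move/(congr1 (@conj_mx R G _ _)); rewrite conj_mul_lift conj_lift_mul conj_mxK.
exact: esym.
Qed.

Lemma positive_diag_gt0 n (F : 'M[C]_n) i : positive_definite F -> 0 < F i i.
Proof.
move=> [_ Fp]; have := Fp (delta_mx i 0).
have -> : (map_mx Num.conj (delta_mx i 0 : 'cV[C]_n))^T = delta_mx 0 i.
  by apply/matrixP => a b; rewrite !mxE rmorph_nat andbC.
rewrite -rowE -colE !mxE; apply; apply/eqP => /matrixP/(_ i 0).
by rewrite !mxE !eqxx => /eqP; rewrite oner_eq0.
Qed.

Lemma positive_diag_unit n (F : 'M[C]_n) :
  positive_definite F -> is_diag_mx F -> F \in unitmx.
Proof.
move=> Fp /is_diag_mxP Fd; rewrite unitmxE.
have -> : F = diag_mx (\row_i F i i).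
  by apply/matrixP => i j; rewrite !mxE; case: eqP => [->|/eqP /Fd //]; rewrite mulr1n.
rewrite det_diag unitfE; apply/prodf_neq0 => i _.
by rewrite mxE gt_eqF // positive_diag_gt0.
Qed.

(* Schur's lemma for u makes the scalar products vanish unless j = l; applied to
   the conjugate of u, it makes them vanish unless k = i. *)
Lemma schur_orthogonality n (u : 'M[A]_n) (F : 'M[C]_n) :
  unitary_corep u -> irreducible_corep u -> modular_matrix u F -> is_diag_mx F ->
  exists c : 'I_n -> C, forall k j i l,
    h (adj (u k j) * u i l) = ((k == i) && (j == l))%:R * c k.
Proof.
move=> uu iu [Fp _ Fc] Fd.
have Fu := positive_diag_unit Fp Fd.
have [n0 _] := iu; pose o := Ordinal n0.
(* By Schur's lemma the squared norm of u_kj is the same in every column j, so the column [o] stands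
   for all. *)
exists (fun k => h (adj (u k o) * u k o)) => k j i l.
have h1 k' i' : exists z, forall j' l', h (adj (u k' j') * u i' l') = (j' == l')%:R * z.
  have [z Tz] := schur_scalar iu (haar_intertwiner k' i' uu uu).
  exists z => j' l'; have /matrixP/(_ j' l') := Tz.
  by rewrite !mxE => ->; rewrite mulr_natl.
have h2 : k != i -> h (adj (u k j) * u i l) = 0.
  move=> ki; have [z Tz] := schur_scalar iu (haar_intertwiner_conj j l uu Fu Fc).
  have /matrixP/(_ k i) := Tz; rewrite !mxE (negPf ki) mulr0n.
  rewrite (bigD1 i) //= big1 ?addr0 => [|i' i'i]; last first.
    have -> : F^T i' i = 0 by rewrite mxE; move/is_diag_mxP: Fd; apply; rewrite eq_sym.
    by rewrite mulr0.
  rewrite !mxE => /eqP; rewrite conjC_eq0 mulf_eq0 (gt_eqF (positive_diag_gt0 i Fp)) orbF.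
  by move/eqP.
have [<-|ki] := eqVneq k i; last by rewrite h2 // mul0r.
by have [z hz] := h1 k k; rewrite !hz eqxx mul1r.
Qed.

Lemma haar_orthogonal m n (u : 'M[A]_m) (v : 'M[A]_n) k j i l :
  unitary_corep u -> unitary_corep v -> irreducible_corep u -> irreducible_corep v ->
  ~ corep_equiv u v -> h (adj (v k j) * u i l) = 0.
Proof.
move=> uu uv iu iv nuv; have Tuv := haar_intertwiner k i uu uv.
have [T0|[r1 r2]] := schur iu iv Tuv.
  by have /matrixP/(_ j l) := T0; rewrite !mxE.
case: nuv; set T := \matrix_(_, _) _ in Tuv r1 r2.
exists T, (pinvmx T); split=> //.
  by apply: mulVpmx; rewrite /row_full r1.
by apply: mulmxVp; rewrite /row_free r2.
Qed.

End Orthogonality.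

(** * Unitary form of the conjugate *)

Section Conjugates.
Context {R : realType} {G : hopf_cstar R}.
Local Notation A := (Cred G).
Local Notation C := R[i].
Local Notation h := (@haar R G).
Local Notation lift := (@lift_mx R G _ _).

Lemma diag_sqrt n (F : 'M[C]_n) : positive_definite F -> is_diag_mx F ->
  exists g g' : 'M[C]_n,
    [/\ g *m g = F, g *m g' = 1%:M, g' *m g = 1%:M, g ^t* = g & g' ^t* = g'].
Proof.
move=> Fp /is_diag_mxP Fd.
have F0 i := positive_diag_gt0 i Fp.
have FE : F = diag_mx (\row_i F i i).
  by apply/matrixP => i j; rewrite !mxE; case: eqP => [->|/eqP /Fd //]; rewrite mulr1n.
have s0 i : sqrtC (F i i) != 0 by rewrite sqrtC_eq0 gt_eqF.
exists (diag_mx (\row_i sqrtC (F i i))), (diag_mx (\row_i (sqrtC (F i i))^-1)).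
have herm (d : 'I_n -> C) : (forall i, 0 <= d i) ->
    (diag_mx (\row_i d i)) ^t* = diag_mx (\row_i d i).
  move=> d0; apply/matrixP => i j; rewrite !mxE eq_sym; case: eqP => [->|_].
    by rewrite !mulr1n conj_Creal // ger0_real.
  by rewrite !mulr0n conjC0.
split.
- rewrite [RHS]FE mulmx_diag; congr diag_mx; apply/rowP => i; rewrite !mxE.
  by rewrite -expr2 sqrtCK.
- rewrite mulmx_diag -diag_const_mx; congr diag_mx; apply/rowP => i; rewrite !mxE.
  by rewrite mulfV.
- rewrite mulmx_diag -diag_const_mx; congr diag_mx; apply/rowP => i; rewrite !mxE.
  by rewrite mulVf.
- by apply: herm => i; rewrite sqrtC_ge0 ltW.
- by apply: herm => i; rewrite invr_ge0 sqrtC_ge0 ltW.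
Qed.

(** The witness is F^(1/2) conj(u) F^(-1/2). With F symmetric because diagonal, the modular relation
    reads u^T F conj(u) = F and conj(u) F^-1 u^T = F^-1, where u^T is the adjoint of conj(u); these
    are the two unitarity relations. *)
Lemma conjugate_corep n (u : 'M[A]_n) (F : 'M[C]_n) :
  unitary_corep u -> irreducible_corep u -> modular_matrix u F -> is_diag_mx F ->
  exists v : 'M[A]_n,
    [/\ unitary_corep v, irreducible_corep v & corep_equiv v (conj_mx u)].
Proof.
move=> uu [n0 iu] [Fp _ [c1 c2]] Fd; have [_ _ cu] := uu.
have Fu := positive_diag_unit Fp Fd.
have [g [g' [gg gg' g'g ga g'a]]] := diag_sqrt Fp Fd.
have FT : F^T = F.
  apply/matrixP => i j; rewrite mxE; have [->//|ij] := eqVneq i j.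
  by move/is_diag_mxP: Fd => Fd; rewrite !Fd // eq_sym.
have Fi : (invmx F)^T = invmx F by rewrite trmx_inv FT.
have iF : invmx F = g' *m g'.
  have gg1 : F *m (g' *m g') = 1%:M by rewrite -gg mulmxA -(mulmxA g) gg' mulmx1.
  by rewrite -[RHS](mulKmx Fu) gg1 mulmx1.
have cT : (lift F *m u *m lift (invmx F))^T = lift (invmx F) *m u^T *m lift F.
  by rewrite mulmx_lift_tr lift_mulmx_tr Fi FT mulmxA.
rewrite cT in c1 c2.
have lFi : lift F *m lift (invmx F) = 1%:M by rewrite -lift_mxM mulmxV // lift_mx1.
have lFi' : lift (invmx F) *m lift F = 1%:M by rewrite -lift_mxM mulVmx // lift_mx1.
have lgg' : lift g *m lift g' = 1%:M by rewrite -lift_mxM gg' lift_mx1.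
have lg'g : lift g' *m lift g = 1%:M by rewrite -lift_mxM g'g lift_mx1.
have e1 : conj_mx u *m lift (invmx F) *m u^T = lift (invmx F).
  by rewrite -[LHS]mulmx1 -lFi !mulmxA -[RHS]mul1mx -c1 !mulmxA.
have e2 : u^T *m lift F *m conj_mx u = lift F.
  by rewrite -[LHS]mul1mx -lFi -[RHS]mulmx1 -c2 !mulmxA.
have auu : adjmx (conj_mx u) = u^T by rewrite /adjmx conj_mxK.
pose v := lift g *m conj_mx u *m lift g'.
have vE : lift g' *m v = conj_mx u *m lift g'.
  by rewrite /v !mulmxA lg'g mul1mx.
exists v; split.
- apply/unitary_corepP; rewrite /v !adjmxM !adjmx_lift ga g'a auu; split.
  + rewrite !mulmxA -(mulmxA _ (lift g) (lift g)) -lift_mxM gg.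
    rewrite -(mulmxA _ u^T) -(mulmxA (lift g')) e2 -gg lift_mxM.
    by rewrite !mulmxA lg'g mul1mx.
  + rewrite !mulmxA -(mulmxA _ (lift g') (lift g')) -lift_mxM -iF.
    rewrite -!(mulmxA (lift g)) e1 iF lift_mxM.
    by rewrite !mulmxA lgg' mul1mx lg'g.
  + by apply: corep_compress; [exact: corep_conj|rewrite g'g lift_mx1 mulmx1].
- split=> // k V w vV.
  (* A subspace invariant under v gives one invariant under conj(u), whose complex conjugate is
     invariant under u and has the same dimension. *)
  have ugV : conj_mx u *m lift (g' *m V) = lift (g' *m V) *m w.
    by rewrite lift_mxM mulmxA -vE -mulmxA vV mulmxA.
  have := congr1 (@conj_mx R G _ _) ugV; rewrite conj_mul_lift conj_lift_mul conj_mxK.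
  move/iu; rewrite mxrank_map.
  have g'u : row_free g' by rewrite row_free_unit; apply: (mulmx1_unit g'g).1.
  suff -> : \rank (g' *m V) = \rank V by [].
  by rewrite -mxrank_tr trmx_mul mxrankMfree ?mxrank_tr // row_free_unit unitmx_tr -row_free_unit.
- exists g', g; split=> //.
Qed.

End Conjugates.

(** * Frobenius reciprocity and decomposition into irreducibles *)

Section Irreducibles.
Context {R : realType} {G : discrete_quantum_group R} {Irr : irreducibles G}.
Local Notation A := (Cred G).
Local Notation C := R[i].
Local Notation lift := (@lift_mx R G _ _).

Lemma conjugate_exists (al : Irr) : exists be, is_conjugate al be.
Proof.
have [F Fm Fd] := irr_modular al.
have [v [uv iv ve]] := conjugate_corep (irr_unitary al) (irr_irreducible al) Fm Fd.
have [be vb] := irr_full Irr uv iv.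
by exists be; apply: corep_equiv_trans (corep_equiv_sym vb) ve.
Qed.

(* Bending the be-leg of T : al -> be (x) ga gives S : be' (x) al -> ga, whose
   adjoint is the required intertwiner. *)
Lemma subcorep_frobenius (al be be' ga : Irr) : is_conjugate be be' ->
  subcorep (irr_mx al) (tensmx (irr_mx be) (irr_mx ga)) ->
  subcorep (irr_mx ga) (tensmx (irr_mx be') (irr_mx al)).
Proof.
move=> [X [X' [XE X'X XX']]] [T TE rT].
(* X intertwines be' with the conjugate of be, so it turns the be-leg of T into an input from be'.
   In the verification of [SE], the resulting adjoint entries of be cancel against those coming from
   T by unitarity. *)
pose S : 'M[C]_(irr_dim ga, irr_dim be' * irr_dim al) :=
  \matrix_(k, rp) \sum_i T (mxtens_index (i, k)) (mxtens_unindex rp).2 *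
     X i (mxtens_unindex rp).1.
have SE : intertwiner (tensmx (irr_mx be') (irr_mx al)) (irr_mx ga) S.
  apply/matrixP => k rq; case: (mxtens_indexP rq) => r q; rewrite lift_mulE mul_liftE.
  set a := irr_mx al; set b := irr_mx be; set b' := irr_mx be'; set c := irr_mx ga.
  have Xb i : \sum_s X i s *: b' s r = \sum_s X s r *: adj (b i s).
    have /matrixP/(_ i r) := XE; rewrite lift_mulE mul_liftE => ->.
    by apply: eq_bigr => s _; rewrite mxE.
  have Ta i : \sum_p T (mxtens_index (i, k)) p *: a p q =
      \sum_j \sum_l' T (mxtens_index (j, l')) q *: (b i j * c k l').
    have /matrixP/(_ (mxtens_index (i, k)) q) := TE; rewrite lift_mulE mul_liftE => ->.
    by rewrite sum_mxtens; apply: eq_bigr => j _; apply: eq_bigr => l' _; rewrite tensmxE.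
  transitivity (\sum_i (\sum_s X i s *: b' s r) * \sum_p T (mxtens_index (i, k)) p *: a p q).
    rewrite sum_mxtens.
    transitivity (\sum_s \sum_p \sum_i
        (T (mxtens_index (i, k)) p * X i s) *: (b' s r * a p q)).
      apply: eq_bigr => s _; apply: eq_bigr => p _.
      rewrite tensmxE mxE scaler_suml; apply: eq_bigr => i _.
      by rewrite !mxtens_indexK.
    rewrite exchange_big /=; under eq_bigr do rewrite exchange_big /=.
    rewrite exchange_big /=; apply: eq_bigr => i _; rewrite mulr_sumr.
    apply: eq_bigr => p _; rewrite mulr_suml; apply: eq_bigr => s _.
    by rewrite -scalerAl -scalerAr scalerA mulrC.
  transitivity (\sum_s X s r *: \sum_j \sum_l' T (mxtens_index (j, l')) q *:
      ((\sum_i adj (b i s) * b i j) * c k l')).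
    transitivity (\sum_i \sum_s \sum_j \sum_l' X s r *:
        (T (mxtens_index (j, l')) q *: (adj (b i s) * b i j * c k l'))).
      apply: eq_bigr => i _; rewrite Xb Ta mulr_suml; apply: eq_bigr => s _.
      rewrite mulr_sumr; apply: eq_bigr => j _; rewrite mulr_sumr; apply: eq_bigr => l' _.
      by rewrite -scalerAl -scalerAr mulrA.
    rewrite exchange_big /=; apply: eq_bigr => s _; rewrite exchange_big /= scaler_sumr.
    apply: eq_bigr => j _; rewrite exchange_big /= scaler_sumr.
    apply: eq_bigr => l' _; rewrite mulr_suml !scaler_sumr.
    by apply: eq_bigr.
  transitivity (\sum_s X s r *: \sum_l' T (mxtens_index (s, l')) q *: c k l').
    apply: eq_bigr => s _; congr (_ *: _); rewrite (bigD1 s) //= [X in _ + X]big1 ?addr0.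
      by apply: eq_bigr => l' _; rewrite unitary_corep_suml ?eqxx ?mul1r //; exact: irr_unitary.
    move=> j js; rewrite big1 // => l' _.
    by rewrite unitary_corep_suml ?(eq_sym s) ?(negPf js) ?mul0r ?scaler0 //; exact: irr_unitary.
  under eq_bigr do rewrite scaler_sumr.
  rewrite exchange_big /=; apply: eq_bigr => l' _; rewrite mxE !mxtens_indexK scaler_suml.
  by apply: eq_bigr => s _; rewrite scalerA mulrC.
have be'al := unitary_corep_tens (irr_unitary be') (irr_unitary al).
have SaE := intertwiner_adj be'al (irr_unitary ga) SE.
exists (S ^t*) => //.
have [Sa0|//] := schur_injective (irr_irreducible ga) SaE.
have S0 : S = 0.
  by rewrite -[S]ctrmxK Sa0; apply/matrixP => i j; rewrite !mxE conjC0.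
(* X is invertible, so bending loses nothing: S = 0 would force T = 0, whereas T has rank
   [irr_dim al] > 0. *)
have T0 : T = 0.
  apply/matrixP => ik p; case: (mxtens_indexP ik) => i k; rewrite [RHS]mxE.
  pose Tk : 'rV[C]_(irr_dim be) := \row_i T (mxtens_index (i, k)) p.
  have TkX : Tk *m X = 0.
    apply/rowP => r; have /matrixP/(_ k (mxtens_index (r, p))) := S0.
    rewrite !mxE !mxtens_indexK => s0; rewrite -[RHS]s0.
    by apply: eq_bigr => i' _; rewrite mxE.
  have /rowP/(_ i) : Tk = 0 by rewrite -[Tk]mulmx1 -XX' mulmxA TkX mul0mx.
  by rewrite !mxE.
have [al0 _] := irr_irreducible al.
by move: rT; rewrite T0 mxrank0 => al00; rewrite -al00 in al0.
Qed.

Lemma length_tensor_dist (l : Irr -> R) (al be ga : Irr) : length_function l ->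
  subcorep (irr_mx al) (tensmx (irr_mx be) (irr_mx ga)) -> `|l al - l ga| <= l be.
Proof.
move=> [_ _ lc lt] sub; have [be' cbe] := conjugate_exists be.
have h1 := lt _ _ _ sub; have h2 := lt _ _ _ (subcorep_frobenius cbe sub).
rewrite (lc _ _ cbe) in h2.
by rewrite ler_norml; apply/andP; split; lra.
Qed.

(** Complete reducibility as an induction on the dimension. The summands come with isometries W1, W2
    rather than up to mere equivalence, which preserves norm estimates; dimension 0 is separate
    because irreducibles have positive dimension. *)
Lemma corep_ind (Pr : forall n, 'M[A]_n -> Prop) :
  (forall u : 'M[A]_0, Pr 0%N u) ->
  (forall n (u : 'M[A]_n) (al : Irr) (T : 'M[C]_(irr_dim al, n)) T',
     unitary_corep u -> intertwiner u (irr_mx al) T -> T' *m T = 1%:M -> T *m T' = 1%:M ->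
     Pr n u) ->
  (forall n (u : 'M[A]_n) r1 r2 (W1 : 'M[C]_(n, r1)) (W2 : 'M[C]_(n, r2)) u1 u2,
     W1 ^t* *m W1 = 1%:M -> W2 ^t* *m W2 = 1%:M ->
     W1 *m W1 ^t* + W2 *m W2 ^t* = 1%:M ->
     u *m lift W1 = lift W1 *m u1 -> u *m lift W2 = lift W2 *m u2 ->
     Pr r1 u1 -> Pr r2 u2 -> Pr n u) ->
  forall n (u : 'M[A]_n), unitary_corep u -> Pr n u.
Proof.
move=> P0 Pirr Psum n; have [m] := ubnP n; elim: m n => // m IH [|n] nm u uu.
  exact: P0.
have [iu|niu] := pselect (irreducible_corep u).
  by have [al [T [T' [h h1 h2]]]] := irr_full Irr uu iu; exact: Pirr h h1 h2.
have [r1 [r2 [W1 [W2 [[rn1 rn2] [WW1 WW2] W12 Pu1 Pu2]]]]] := corep_split uu (ltn0Sn n) niu.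
have [uu1 h1] := unitary_corep_compress uu WW1 Pu1.
have [uu2 h2] := unitary_corep_compress uu WW2 Pu2.
apply: (Psum _ _ _ _ _ _ _ _ WW1 WW2 W12 h1 h2).
  by apply: IH => //; apply: leq_trans rn1 _.
by apply: IH => //; apply: leq_trans rn2 _.
Qed.

(** Algebraic half of Peter-Weyl: the entries of the chosen irreducibles span all matrix
    coefficients. *)
Lemma matrix_coefficients_ind (Q : A -> Prop) :
  Q 0 -> (forall (z : C) a b, Q a -> Q b -> Q (z *: a + b)) ->
  (forall (al : Irr) i j, Q (irr_mx al i j)) ->
  forall a, matrix_coefficients G a -> Q a.
Proof.
move=> Q0 Qcomb Qirr.
have Qsum (I : Type) (r : seq I) (z : I -> C) (f : I -> A) :
    (forall i, Q (f i)) -> Q (\sum_(i <- r) z i *: f i).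
  by move=> hf; elim: r => [|i r IH]; rewrite ?big_nil ?big_cons //; exact: Qcomb.
have Qlift n m p q (X : 'M[C]_(n, m)) (v : 'M[A]_(m, p)) (Y : 'M[C]_(p, q)) :
    (forall i j, Q (v i j)) -> forall i j, Q ((lift X *m v *m lift Y) i j).
  move=> hv i j; rewrite mul_liftE; apply: (Qsum) => k.
  by rewrite lift_mulE; apply: (Qsum).
suff Qu n (u : 'M[A]_n) : unitary_corep u -> forall i j, Q (u i j).
  move=> a [n [u [c [uu ->]]]].
  have one (I : Type) (r : seq I) (f : I -> A) : \sum_(i <- r) f i = \sum_(i <- r) 1 *: f i.
    by apply: eq_bigr => i _; rewrite scale1r.
  by rewrite one; apply: (Qsum) => i; apply: (Qsum) => j; exact: Qu.
move: n u; apply: corep_ind.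
- by move=> u [].
- move=> n u al T T' uu Tu T'T TT' i j.
  have -> : u = lift T' *m irr_mx al *m lift T.
    by rewrite -mulmxA -Tu mulmxA -lift_mxM T'T lift_mx1 mul1mx.
  exact: Qlift.
- move=> n u r1 r2 W1 W2 u1 u2 _ _ W12 h1 h2 Q1 Q2 i j.
  have -> : u = lift W1 *m u1 *m lift (W1 ^t*) + lift W2 *m u2 *m lift (W2 ^t*).
    by rewrite -h1 -h2 -!mulmxA -!lift_mxM -mulmxDr -lift_mxD W12 lift_mx1 mulmx1.
  rewrite mxE -[X in Q (X + _)]scale1r; apply: Qcomb; exact: Qlift.
Qed.

(** The conjugate matrix need not be unitary, so its entries are expressed through those of an
    equivalent unitary corepresentation. *)
Lemma matrix_coefficients_adj a : matrix_coefficients G a -> matrix_coefficients G (adj a).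
Proof.
move: a; apply: matrix_coefficients_ind => [|z a b ha hb|al i j].
- by rewrite adj0; exact: matrix_coefficients0.
- by rewrite adjD adjZ; exact: matrix_coefficients_comb.
have [F Fm Fd] := irr_modular al.
have [v [uv _ [T [T' [Tv T'T TT']]]]] :=
  conjugate_corep (irr_unitary al) (irr_irreducible al) Fm Fd.
have -> : adj (irr_mx al i j) = (lift T *m v *m lift T') i j.
  by rewrite Tv -mulmxA -lift_mxM TT' lift_mx1 mulmx1 mxE.
rewrite mul_liftE; apply: matrix_coefficients_sum => k.
by rewrite lift_mulE; apply: matrix_coefficients_sum => l; exact: matrix_coefficient_entry.
Qed.

End Irreducibles.

Lemma ctrmxD (C : numClosedFieldType) m n (M N : 'M[C]_(m, n)) :
  (M + N) ^t* = M ^t* + N ^t*.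
Proof. by apply/matrixP => i j; rewrite !mxE rmorphD. Qed.

Lemma ctrmx_orthogonal_sym (C : numClosedFieldType) m n p
  (M : 'M[C]_(m, n)) (N : 'M[C]_(m, p)) : M ^t* *m N = 0 -> N ^t* *m M = 0.
Proof.
move=> MN; have := congr1 (fun X : 'M[C]_(n, p) => map_mx Num.conj X^T) MN.
by rewrite ctrmxM ctrmxK trmx0 map_mx0.
Qed.

(** * The length operator and its derivations *)

Section SquareNorm.
Context {C : numClosedFieldType}.

Definition sqnorm n (x : 'cV[C]_n) : C := (x ^t* *m x) 0 0.

Lemma sqnormE n (x : 'cV[C]_n) : sqnorm x = \sum_i `|x i 0| ^+ 2.
Proof.
by rewrite /sqnorm mxE; apply: eq_bigr => i _; rewrite !mxE mulrC normCK.
Qed.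

Lemma sqnormZ n z (x : 'cV[C]_n) : sqnorm (z *: x) = `|z| ^+ 2 * sqnorm x.
Proof.
by rewrite !sqnormE mulr_sumr; apply: eq_bigr => i _; rewrite mxE normrM exprMn.
Qed.

Lemma sqnorm_split n r1 r2 (W1 : 'M[C]_(n, r1)) (W2 : 'M[C]_(n, r2)) x1 x2 :
  W1 ^t* *m W1 = 1%:M -> W2 ^t* *m W2 = 1%:M -> W1 ^t* *m W2 = 0 ->
  sqnorm (W1 *m x1 + W2 *m x2) = sqnorm x1 + sqnorm x2.
Proof.
move=> h1 h2 h12; have h21 := ctrmx_orthogonal_sym h12.
have prod m (V : 'M[C]_(n, m)) p (V' : 'M[C]_(n, p)) z z' :
    (V *m z) ^t* *m (V' *m z') = z ^t* *m (V ^t* *m V') *m z' :> 'M[C]_1.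
  by rewrite ctrmxM !mulmxA.
rewrite /sqnorm ctrmxD mulmxDl !mulmxDr !prod h1 h2 h12 h21.
by rewrite !mulmx1 !mulmx0 !mul0mx addr0 add0r mxE.
Qed.

End SquareNorm.

Section LengthOperator.
Context {R : realType} {G : discrete_quantum_group R} {Irr : irreducibles G}.
Context (l : Irr -> R).
Local Notation A := (Cred G).
Local Notation C := R[i].
Local Notation lift := (@lift_mx R G _ _).
Local Notation e := (@coef_vector R G Irr).
Local Notation lam := (fun k : coef_index => l (tag k)).
Local Notation D := (diagop e lam).

Definition basis_index (al : Irr) (i j : 'I_(irr_dim al)) : @coef_index R G Irr :=
  existT _ al (i, j).

(** That c depends on the row alone is what later bounds operators acting on the column index by the
    norm of their matrix. *)
Lemma coef_vector_dot (al : Irr) : exists c : 'I_(irr_dim al) -> C, forall i j k m,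
  dot (e (basis_index i j)) (e (basis_index k m)) = ((i == k) && (j == m))%:R * c i.
Proof.
have [F Fm Fd] := irr_modular al.
have [c hc] := schur_orthogonality (irr_unitary al) (irr_irreducible al) Fm Fd.
exists c => i j k m; rewrite Lam_dot /= hc (eq_sym i) (eq_sym j).
by case: eqP => [->|_]; rewrite ?mul0r.
Qed.

Lemma coef_vector_orthogonal (k k' : @coef_index R G Irr) : k != k' -> dot (e k) (e k') = 0.
Proof.
case: k => al [i j]; case: k' => be [i' j'].
move: i' j'; have [<-|ab] := eqVneq al be => i' j'.
  move=> ne; have [c hc] := coef_vector_dot al; rewrite hc.
  case: eqP => [ii|]; last by rewrite mul0r.
  case: eqP => [jj|]; last by rewrite mul0r.
  by rewrite /basis_index ii jj eqxx in ne.
move=> _; rewrite Lam_dot; apply: haar_orthogonal; try exact: irr_unitary;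
  try exact: irr_irreducible.
by move/irr_inj/eqP; apply/negP.
Qed.

(** The functional a -> dot (Lam a) x is bounded for the C*-norm and vanishes on irreducible
    coefficients, hence everywhere by density. *)
Lemma coef_vector_total x : (forall k, dot x (e k) = 0) -> x = 0.
Proof.
move=> hx; apply: (dot_dense_eq0 (@Lam_dense R G)) => _ [a _ <-].
pose f a := dot (Lam G a) x.
have fl : scalar f.
  by move=> z b c; rewrite /f linearP linearDl /= dotZl.
pose f' : {scalar A} := HB.pack f (GRing.isLinear.Build _ _ _ _ f fl).
apply: (@matrix_coefficients_density _ _ f' `|x|) => [b|n u i j uu].
  by apply: (le_trans (cauchy_schwarz _ _)); rewrite mulrC ler_wpM2l ?norm_Lam.
move: (matrix_coefficient_entry i j uu); move: (u i j) => b.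
apply: (@matrix_coefficients_ind R G Irr (fun b => f b = 0)) => [|z b' c hb hc|al i' j'].
- by rewrite /f linear0 linear0l.
- by rewrite fl hb hc mulr0 addr0.
- by rewrite /f dotC (hx (basis_index i' j')) conjC0.
Qed.

Let orth := coef_vector_orthogonal.
Let total := coef_vector_total.

(** The summability condition in the definition of the domain is Bessel's inequality for the image
    y. *)
Lemma length_operatorE : length_operator l = D.
Proof.
apply/funext => x; apply/funext => y; apply/propext; split=> [[a [hx _ hy]]|Dxy].
  exact: (diagop_series orth hx hy).
exists (coef e x); split; first exact: coef_series_cvg.
- have re (z : C) : 0 <= z -> (complex.Re z)%:C = z.
    by move=> z0; apply: RRe_real; exact: ger0_real.
  apply: (@le_lt_trans _ _ (complex.Re (`|y| ^+ 2))%:E); last exact: ltry.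
  apply: ub_ereal_sup => _ [B [fB _] <-].
  rewrite fsbig_finite // sumEFin lee_fin -lecR re ?exprn_ge0 //.
  apply: le_trans (bessel orth y (fset_set B)); rewrite partial_sumE rmorph_sum /=.
  apply: ler_sum => k _; rewrite !expr2 !rmorphM /= -!expr2 !re // -dot_norm.
  rewrite (diagop_coef _ Dxy) normrM exprMn.
  have -> : `|(l (tag k))%:C| ^+ 2 = (l (tag k))%:C ^+ 2 :> C.
    by rewrite real_normK // complex_real.
  by [].
- exact: (diagop_coef_cvg orth total Dxy).
Qed.

Lemma diagop_basis k : D (e k) ((lam k)%:C *: e k).
Proof.
move=> j; rewrite dotZl; have [->//|ij] := eqVneq k j.
by rewrite orth // !mulr0.
Qed.

Lemma diagop_lift m n p q (u w : 'M[A]_(m, n)) (X : 'M[C]_(p, m)) (Y : 'M[C]_(n, q)) :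
  (forall i j, D (Lam G (u i j)) (Lam G (w i j))) ->
  forall i j, D (Lam G ((lift X *m u *m lift Y) i j)) (Lam G ((lift X *m w *m lift Y) i j)).
Proof.
move=> uw i j; rewrite !mul_liftE !linear_sum; apply: diagop_sum => k.
rewrite !linearZ /= -[_ *: _]addr0 -[X in D _ X]addr0; apply: diagop_comb; last exact: diagop0.
rewrite !lift_mulE !linear_sum; apply: diagop_sum => k'.
rewrite !linearZ /= -[_ *: _]addr0 -[X in D _ X]addr0; apply: diagop_comb; last exact: diagop0.
exact: uw.
Qed.

Lemma mul_lift_scalar m n (X : 'M[A]_(m, n)) (z : C) i j :
  (X *m lift z%:M) i j = z *: X i j.
Proof.
rewrite mul_liftE (bigD1 j) //= big1 ?addr0 => [|k kj]; last first.
  by rewrite mxE (negPf kj) mulr0n scale0r.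
by rewrite mxE eqxx.
Qed.

(* y is the operator acting as [l al] on each copy of al inside v. *)
Lemma length_on_corep n (v : 'M[A]_n) : unitary_corep v ->
  exists y : 'M[C]_n,
    (forall i j, D (Lam G (v i j)) (Lam G ((v *m lift y) i j))) /\
    forall t K : R, (forall al : Irr, subcorep (irr_mx al) v -> `|l al - t| <= K) ->
      forall x, sqnorm ((y - (t%:C)%:M) *m x) <= (K ^+ 2)%:C * sqnorm x.
Proof.
move: n v; apply: corep_ind => [v|n v al T T' uv Tv T'T TT'|].
- exists 0; split=> [[]//|t K _ x].
  by rewrite !sqnormE !big_ord0 mulr0.
- exists ((l al)%:C)%:M; split=> [|t K hK x].
    have -> : v = lift T' *m irr_mx al *m lift T.
      by rewrite -mulmxA -Tv mulmxA -lift_mxM T'T lift_mx1 mul1mx.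
    move=> i j.
    have -> : lift T' *m irr_mx al *m lift T *m lift ((l al)%:C)%:M =
        lift T' *m (irr_mx al *m lift ((l al)%:C)%:M) *m lift T.
      rewrite -!mulmxA -!lift_mxM; congr (_ *m (_ *m lift_mx _)).
      by rewrite mul_scalar_mx mul_mx_scalar.
    apply: diagop_lift => i' j'; rewrite mul_lift_scalar linearZ.
    exact: (diagop_basis (basis_index i' j')).
  rewrite -raddfB /= mul_scalar_mx sqnormZ -rmorphB ler_wpM2r //.
    by rewrite sqnormE sumr_ge0 // => i _; rewrite exprn_ge0.
  rewrite real_normK ?complex_real // -rmorphXn lecR -real_normK ?num_real //.
  have sub : subcorep (irr_mx al) v.
    by apply: corep_equiv_subcorep; apply: corep_equiv_sym; exists T, T'.
  by rewrite ler_sqr ?nnegrE ?(le_trans _ (hK al sub)) // hK.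
- move=> n v r1 r2 W1 W2 v1 v2 WW1 WW2 W12 h1 h2 [y1 [Dy1 b1]] [y2 [Dy2 b2]].
  have W1W2 : W1 ^t* *m W2 = 0.
    (* Expanding the left side yields W1^* W2 twice, so W1^* W2 = 0. This orthogonality lets both
       summands keep the same bound K. *)
    have : W1 ^t* *m (W1 *m W1 ^t* + W2 *m W2 ^t*) *m W2 = W1 ^t* *m W2.
      by rewrite W12 mulmx1.
    rewrite mulmxDr mulmxDl !mulmxA WW1 mul1mx -!mulmxA WW2 mulmx1.
    by move/eqP; rewrite -subr_eq0 addrK => /eqP.
  have vE : v = lift W1 *m v1 *m lift (W1 ^t*) + lift W2 *m v2 *m lift (W2 ^t*).
    by rewrite -h1 -h2 -!mulmxA -!lift_mxM -mulmxDr -lift_mxD W12 lift_mx1 mulmx1.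
  exists (W1 *m y1 *m W1 ^t* + W2 *m y2 *m W2 ^t*); split=> [i j|t K hK x].
    have -> : v *m lift (W1 *m y1 *m W1 ^t* + W2 *m y2 *m W2 ^t*) =
      lift W1 *m (v1 *m lift y1) *m lift (W1 ^t*) +
      lift W2 *m (v2 *m lift y2) *m lift (W2 ^t*).
      by rewrite lift_mxD mulmxDr !lift_mxM !mulmxA h1 h2.
    have addE (X Y : 'M[A]_n) : (X + Y) i j = X i j + Y i j by rewrite mxE.
    rewrite [in Lam _ (v i j)]vE !addE !linearD /=.
    by rewrite -[X in D (X + _)]scale1r -[X in D _ (X + _)]scale1r;
      apply: diagop_comb; exact: diagop_lift.
  have -> : (W1 *m y1 *m W1 ^t* + W2 *m y2 *m W2 ^t* - (t%:C)%:M) *m x =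
    W1 *m ((y1 - (t%:C)%:M) *m (W1 ^t* *m x)) + W2 *m ((y2 - (t%:C)%:M) *m (W2 ^t* *m x)).
    rewrite -[(t%:C)%:M in LHS]mulmx1 -W12.
    rewrite !mulmxBl !mulmxBr !mulmxDl mulmxDr mulmxDl !mul_scalar_mx -!scalemxAr !mulmxA.
    by rewrite opprD addrACA !scalemxAl.
  have xE : sqnorm x = sqnorm (W1 ^t* *m x) + sqnorm (W2 ^t* *m x).
    by rewrite -(sqnorm_split _ _ WW1 WW2 W1W2) !mulmxA -mulmxDl W12 mul1mx.
  have sub r (W : 'M[C]_(n, r)) v' : W ^t* *m W = 1%:M -> v *m lift W = lift W *m v' ->
      forall al : Irr, subcorep (irr_mx al) v' -> subcorep (irr_mx al) v.
    move=> WW vW al [T TE rT]; exists (W *m T).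
      exact: (intertwiner_comp TE (esym vW)).
    apply/eqP; rewrite eqn_leq rank_leq_col -{1}rT.
    have {1}-> : T = W ^t* *m (W *m T) by rewrite mulmxA WW mul1mx.
    exact: mxrankM_maxr.
  rewrite (sqnorm_split _ _ WW1 WW2 W1W2) xE mulrDr lerD //.
    by apply: b1 => al s; apply: hK; exact: (sub _ W1 v1 WW1 h1).
  by apply: b2 => al s; apply: hK; exact: (sub _ W2 v2 WW2 h2).
Qed.

Lemma diagop_functional x y z : D x y -> D x z -> y = z.
Proof. by move=> xy xz; apply: (dot_basis_ext total) => k; rewrite xy xz. Qed.

(** Regularity quantifies over every bounded operator that represents the commutator; density of the
    domain leaves only one. *)
Lemma commutator_unique T S S' : bounded_op S -> bounded_op S' ->
  commutator D T S -> commutator D T S' -> S = S'.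
Proof.
move=> bS bS' cS cS'; apply/funext.
have [dD _] := diagop_selfadjoint orth total lam.
apply: (bounded_op_dense_ext dD bS bS') => x [y Dxy].
exact: (addIr _ (diagop_functional (cS _ _ Dxy) (cS' _ _ Dxy))).
Qed.

Lemma commutator_comb z T S T' S' : commutator D T S -> commutator D T' S' ->
  commutator D (fun x => z *: T x + T' x) (fun x => z *: S x + S' x).
Proof.
move=> cT cT' x y Dxy; have := diagop_comb z (cT _ _ Dxy) (cT' _ _ Dxy).
by rewrite scalerDr addrACA.
Qed.

Lemma commutator_sum (J : Type) (r : seq J) (T S : J -> l2 G -> l2 G) :
  (forall j, commutator D (T j) (S j)) ->
  commutator D (fun x => \sum_(j <- r) T j x) (fun x => \sum_(j <- r) S j x).
Proof.
by move=> cT x y Dxy; rewrite -big_split; apply: diagop_sum => j; exact: cT.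
Qed.

Lemma derivation_dom_bounded n T : derivation_dom D n T -> bounded_op T.
Proof. by case: n => [|n] // []. Qed.

Lemma derivation_dom_comb z n T T' : derivation_dom D n T -> derivation_dom D n T' ->
  derivation_dom D n (fun x => z *: T x + T' x).
Proof.
elim: n T T' => [|n IH] T T' /=; first exact: bounded_op_comb.
move=> [bT [S cS dS]] [bT' [S' cS' dS']]; split; first exact: bounded_op_comb.
by exists (fun x => z *: S x + S' x); [exact: commutator_comb|exact: IH].
Qed.

Lemma derivation_dom0 n : derivation_dom D n (fun=> 0).
Proof.
elim: n => [|n IH]; first exact: bounded_op_zero.
split; first exact: bounded_op_zero.
by exists (fun=> 0) => // x y _; rewrite addr0; exact: diagop0.
Qed.

End LengthOperator.

(** * Sums over whole blocks of indices *)

Section FiberSums.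
Context {I : choiceType} {J : I -> finType}.
Local Notation K := {i : I & J i}.

Definition fibers (r : seq I) : seq K := [seq existT _ i j | i <- r, j <- enum (J i)].

Lemma fibers_uniq r : uniq r -> uniq (fibers r).
Proof.
move=> ur; rewrite /fibers.
apply: (@allpairs_uniq_dep I (fun i => J i) K (existT (fun i => J i))) => // [i _|].
  exact: enum_uniq.
by move=> [i j] [i' j'].
Qed.

Lemma mem_fibers r k : (k \in fibers r) = (tag k \in r).
Proof.
pose P := @allpairsPdep I (fun i => J i) K (existT (fun i => J i)) r (fun i => enum (J i)) k.
apply/P/idP => [[i [j [ir _ ->]]]//|]; case: {P} k => i j /= ir.
by exists i, j; split=> //; rewrite mem_enum.
Qed.

Lemma big_fibers (V : nmodType) r (f : K -> V) :
  \sum_(k <- fibers r) f k = \sum_(i <- r) \sum_(j : J i) f (existT _ i j).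
Proof.
rewrite big_allpairs_dep; apply: eq_bigr => i _.
by rewrite big_enum.
Qed.

(** A finite set of indices may cut through blocks; padding with zeros completes them, so that a
    matrix inequality applies to each whole block. *)
Lemma sum_fset_fibers (V : nmodType) (F : {fset K}) (f : K -> V) :
  \sum_(k <- F) f k =
  \sum_(k <- fibers (undup [seq tag k | k <- F])) if k \in F then f k else 0.
Proof.
rewrite -big_mkcond -big_filter; apply: perm_big; apply: uniq_perm => [||k].
- exact: fset_uniq.
- by rewrite filter_uniq // fibers_uniq // undup_uniq.
- rewrite mem_filter mem_fibers mem_undup; case: (boolP (k \in F)) => //= kF.
  by apply/esym/mapP; exists k.
Qed.

End FiberSums.

(** * Iterated commutators of coefficients *)

Section Derivations.
Context {R : realType} {G : discrete_quantum_group R} {Irr : irreducibles G}.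
Context (l : Irr -> R).
Context (hl : length_function l).
Local Notation A := (Cred G).
Local Notation C := R[i].
Local Notation e := (@coef_vector R G Irr).
Local Notation lam := (fun k : coef_index => l (tag k)).
Local Notation D := (diagop e lam).
Let orth := @coef_vector_orthogonal R G Irr.
Let total := @coef_vector_total R G Irr.

Lemma norm_seq_sum (s : seq (@coef_index R G Irr)) (c : coef_index -> C) : uniq s ->
  `|\sum_(k <- s) c k *: e k| ^+ 2 = \sum_(k <- s) `|c k| ^+ 2 * dot (e k) (e k).
Proof.
move=> us; have := norm_partial_sum orth c [fset k in s]%fset.
rewrite !partial_sumE.
have ps : perm_eq [fset k in s]%fset s.
  by apply: uniq_perm => // k; rewrite !inE.
by rewrite !(perm_big _ ps).
Qed.

Lemma big_coef_fibers (V : nmodType) (r : seq Irr) (f : @coef_index R G Irr -> V) :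
  \sum_(k <- fibers r) f k =
  \sum_(ga <- r) \sum_(i < irr_dim ga) \sum_(b < irr_dim ga) f (basis_index i b).
Proof.
rewrite big_fibers; apply: eq_bigr => ga _.
by rewrite [RHS]pair_big; apply: eq_bigr => -[].
Qed.

Context (be : Irr).
Let d := irr_dim be.

(** [length_on_corep] for be (x) ga with t = l ga; [length_tensor_dist] provides K = l be. The row
    indices i and a stay fixed, and z acts on the column pair (j, b). *)
Lemma fiber_operators : exists z : forall ga : Irr, 'M[C]_(d * irr_dim ga),
  (forall ga x, sqnorm (z ga *m x) <= (l be ^+ 2)%:C * sqnorm x) /\
  forall ga i a j b, D (Lam G (irr_mx be i j * irr_mx ga a b))
    (\sum_p \sum_b' z ga (mxtens_index (p, b')) (mxtens_index (j, b)) *: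
         Lam G (irr_mx be i p * irr_mx ga a b') +
       (l ga)%:C *: Lam G (irr_mx be i j * irr_mx ga a b)).
Proof.
have ex (ga : Irr) := length_on_corep l (unitary_corep_tens (irr_unitary be) (irr_unitary ga)).
pose y ga := sval (cid (ex ga)).
have hy ga := svalP (cid (ex ga)).
exists (fun ga => y ga - ((l ga)%:C)%:M); split=> [ga x|ga i a j b].
  have [_ b] := hy ga; apply: b => al sub; exact: length_tensor_dist hl sub.
have [/(_ (mxtens_index (i, a)) (mxtens_index (j, b))) Dy _] := hy ga.
rewrite tensmxE mul_liftE sum_mxtens linear_sum /= in Dy.
suff <- : \sum_p Lam G (\sum_b' y ga (mxtens_index (p, b')) (mxtens_index (j, b)) *:
    tensmx (irr_mx be) (irr_mx ga) (mxtens_index (i, a)) (mxtens_index (p, b'))) =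
  \sum_p \sum_b' (y ga - ((l ga)%:C)%:M) (mxtens_index (p, b')) (mxtens_index (j, b)) *:
         Lam G (irr_mx be i p * irr_mx ga a b') +
       (l ga)%:C *: Lam G (irr_mx be i j * irr_mx ga a b) by [].
have -> : (l ga)%:C *: Lam G (irr_mx be i j * irr_mx ga a b) =
   \sum_p \sum_b' (((l ga)%:C)%:M : 'M[C]_(d * irr_dim ga)) (mxtens_index (p, b')) (mxtens_index (j, b)) *:
         Lam G (irr_mx be i p * irr_mx ga a b').
  rewrite (bigD1 j) //= (bigD1 b) //= !big1 ?addr0 => [|p pj|b' b'b].
  - by rewrite mxE eqxx.
  - rewrite big1 // => b' _; rewrite mxE (can_eq (@mxtens_indexK _ _)) xpair_eqE.
    by rewrite (negPf pj) scale0r.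
  - by rewrite mxE (can_eq (@mxtens_indexK _ _)) xpair_eqE (negPf b'b) andbF scale0r.
rewrite -big_split /=; apply: eq_bigr => p _; rewrite linear_sum -big_split /=.
apply: eq_bigr => b' _; rewrite linearZ tensmxE -scalerDl /=; congr (_ *: _).
by rewrite !mxE subrK.
Qed.

(* The commutator of D with the matrix (u_ij) of be is the product of (u_ij)
   with (Z_pj): for each ga, the matrix z ga is [length on be (x) ga] - l ga,
   which has norm at most l be. *)
Lemma commutator_matrix : exists Z : 'I_d -> 'I_d -> l2 G -> l2 G,
  [/\ forall p j, bounded_op (Z p j),
      forall p j, commutator D (Z p j) (fun=> 0)
    & forall i j, commutator D (@reg R G (irr_mx be i j))
        (fun x => \sum_p reg (irr_mx be i p) (Z p j x))].
Proof.
have [z [zb zD]] := fiber_operators.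
(* The value prescribed at the basis vector (ga, a, b): the block (p, j) of [z ga], applied to the
   column b with the row a fixed. *)
pose t p j (k : coef_index) : l2 G := let: existT ga ab := k in
  \sum_b' z ga (mxtens_index (p, b')) (mxtens_index (j, ab.2)) *: e (basis_index ab.1 b').
pose c (ga : Irr) := sval (cid (coef_vector_dot ga)).
have hc (ga : Irr) := svalP (cid (coef_vector_dot ga)).
have K0 : 0 <= (l be ^+ 2)%:C :> C by rewrite ler0c sqr_ge0.
have ext p j : exists2 Z, bounded_op Z & forall k, Z (e k) = t p j k.
  apply: (extend_bounded orth K0) => a F.
  pose a' k := if k \in F then a k else 0.
  pose r := undup [seq tag k | k <- F].
  have ur : uniq (fibers (J := fun ga => ('I_(irr_dim ga) * 'I_(irr_dim ga))%type) r).
    by rewrite fibers_uniq // undup_uniq.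
  pose w (k : @coef_index R G Irr) : C := let: existT ga ab := k in
    \sum_b a' (basis_index ab.1 b) * z ga (mxtens_index (p, ab.2)) (mxtens_index (j, b)).
  have -> : partial_sum (fun k => a k *: t p j k) F =
      \sum_(k <- fibers r) w k *: e k.
    rewrite partial_sumE sum_fset_fibers !big_coef_fibers; apply: eq_bigr => ga _.
    apply: eq_bigr => i _.
    transitivity (\sum_b a' (basis_index i b) *: t p j (@basis_index _ _ _ ga i b)).
      by apply: eq_bigr => b _; rewrite /a'; case: ifP => //; rewrite scale0r.
    rewrite /=.
    under eq_bigr do rewrite scaler_sumr.
    rewrite exchange_big /=; apply: eq_bigr => b _; rewrite scaler_suml.
    by apply: eq_bigr => b' _; rewrite scalerA.
  rewrite norm_seq_sum //.
  have -> : partial_sum (fun k => `|a k| ^+ 2 * dot (e k) (e k)) F =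
      \sum_(k <- fibers r) `|a' k| ^+ 2 * dot (e k) (e k).
    rewrite partial_sumE sum_fset_fibers; apply: eq_bigr => k _; rewrite /a'.
    by case: ifP => // _; rewrite normr0 expr0n mul0r.
  rewrite !big_coef_fibers mulr_sumr; apply: ler_sum => ga _.
  rewrite mulr_sumr; apply: ler_sum => i _.
  under eq_bigr do rewrite hc !eqxx mul1r.
  under [X in _ <= _ * X]eq_bigr do rewrite hc !eqxx mul1r.
  (* Within the row i all columns have the same squared norm, which factors out of both sides. *)
  rewrite -!mulr_suml mulrA ler_wpM2r //.
    by have := dotxx_ge0 (e (basis_index i i)); rewrite hc !eqxx mul1r.
  (* x carries the coefficients of the row i in its j-th slot and zero elsewhere; w is then the p-th
     slot of [z ga *m x], whose norm is at most that of the whole vector. *)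
  pose x : 'cV[C]_(d * irr_dim ga) := \col_q
    if (mxtens_unindex q).1 == j then a' (basis_index i (mxtens_unindex q).2) else 0.
  have := zb ga x; rewrite !sqnormE !sum_mxtens => hx.
  have xE : \sum_j' \sum_b `|x (mxtens_index (j', b)) 0| ^+ 2 =
      \sum_b `|a' (basis_index i b)| ^+ 2.
    rewrite (bigD1 j) //= [X in _ + X]big1 ?addr0 => [|j' jj'].
      by apply: eq_bigr => b _; rewrite mxE !mxtens_indexK /= eqxx.
    by rewrite big1 // => b _; rewrite mxE !mxtens_indexK /= (negPf jj') normr0 expr0n.
  have wE b' : (z ga *m x) (mxtens_index (p, b')) 0 = w (basis_index i b').
    rewrite mxE sum_mxtens (bigD1 j) //= [X in _ + X]big1 ?addr0 => [|j' jj'].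
      by apply: eq_bigr => b _; rewrite mxE !mxtens_indexK /= eqxx mulrC.
    by rewrite big1 // => b _; rewrite mxE !mxtens_indexK /= (negPf jj') mulr0.
  rewrite xE in hx; apply: le_trans hx; rewrite (bigD1 p) //=.
  under [X in _ <= X + _]eq_bigr do rewrite wE.
  rewrite lerDl; apply: sumr_ge0 => p' _; apply: sumr_ge0 => b' _.
  by rewrite exprn_ge0.
pose Z p j := s2val (cid2 (ext p j)).
have bZ p j : bounded_op (Z p j) := s2valP (cid2 (ext p j)).
have Ze p j k : Z p j (e k) = t p j k := s2valP' (cid2 (ext p j)) k.
exists Z; split=> // [p j|i j].
  (* [Z p j] preserves the block of ga, on which D is the scalar l ga. *)
  apply: (diagop_commutator orth total (bZ p j) bounded_op_zero) => -[ga [a b]].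
  rewrite add0r Ze /= scaler_sumr; apply: diagop_sum => b'.
  rewrite -[X in D X]addr0 -[X in D _ X]addr0 [_ *: (_ *: _)]scalerA mulrC -scalerA.
  apply: diagop_comb; last exact: diagop0.
  exact: (diagop_basis _ (basis_index a b')).
have bS : bounded_op (fun x => \sum_p reg (irr_mx be i p) (Z p j x)).
  by apply: bounded_op_sum_op => p; apply: bounded_op_comp => //; exact: reg_bounded.
apply: (diagop_commutator orth total (reg_bounded _) bS) => -[ga [a b]].
rewrite [X in D X]reg_Lam [X in _ + _ *: X]reg_Lam.
have := zD ga i a j b; congr (D _ (_ + _)); apply: eq_bigr => p _.
rewrite Ze /= (bounded_op_sum _ _ _ (reg_bounded _)); apply: eq_bigr => b' _.
by rewrite (bounded_opZ _ _ (reg_bounded _)) reg_Lam.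
Qed.

(** The induction runs over a class stable under commutators with D: sums of u_ip Y_p with bounded
    Y_p commuting with D. A commutator replaces Y_q by sum_p Z_qp Y_p, which commutes with D again,
    and Y_p = delta_pj gives u_ij itself. *)
Lemma derivation_dom_irr n i j : derivation_dom D n (@reg R G (irr_mx be i j)).
Proof.
have [Z [bZ cZ cu]] := commutator_matrix.
suff dY m (Y : 'I_d -> l2 G -> l2 G) : (forall p, bounded_op (Y p)) ->
    (forall p, commutator D (Y p) (fun=> 0)) ->
    derivation_dom D m (fun x => \sum_p reg (irr_mx be i p) (Y p x)).
  pose Y p (x : l2 G) := if p == j then x else 0.
  have -> : @reg R G (irr_mx be i j) = (fun x => \sum_p reg (irr_mx be i p) (Y p x)).
    apply/funext => x; rewrite (bigD1 j) //= big1 ?addr0 => [|p pj]; rewrite /Y.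
      by rewrite eqxx.
    by rewrite (negPf pj) (bounded_op0 (reg_bounded _)).
  apply: dY => p; rewrite /Y; case: (p == j).
  - by split=> //; exists 1 => x; rewrite mul1r.
  - exact: bounded_op_zero.
  - by move=> x y Dxy; rewrite add0r.
  - by move=> x y _; rewrite addr0; exact: diagop0.
elim: m Y => [|m IH] Y bY cY.
  by apply: bounded_op_sum_op => p; apply: bounded_op_comp => //; exact: reg_bounded.
split.
  by apply: bounded_op_sum_op => p; apply: bounded_op_comp => //; exact: reg_bounded.
pose Y' q x := \sum_p Z q p (Y p x).
exists (fun x => \sum_q reg (irr_mx be i q) (Y' q x)); last first.
  apply: IH => q.
    by apply: bounded_op_sum_op => p; exact: bounded_op_comp.
  have -> : (fun=> 0 : l2 G) = (fun=> \sum_(p < d) 0) by rewrite big1.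
  apply: commutator_sum => p x y Dxy; rewrite add0r.
  have := cY p _ _ Dxy; rewrite add0r => /(cZ q p).
  by rewrite add0r.
have -> : (fun x => \sum_q reg (irr_mx be i q) (Y' q x)) =
    (fun x => \sum_p \sum_q reg (irr_mx be i q) (Z q p (Y p x))).
  apply/funext => x; rewrite exchange_big /=; apply: eq_bigr => q _.
  by rewrite (bounded_op_sum _ _ _ (reg_bounded _)).
apply: commutator_sum => p x y Dxy.
by have := cY p _ _ Dxy; rewrite add0r => /(cu i p).
Qed.

End Derivations.

(** * The regular spectral triple *)

Section SpectralTriple.
Context {R : realType} {G : discrete_quantum_group R} {Irr : irreducibles G}.
Context (l : Irr -> R).
Local Notation A := (Cred G).
Local Notation e := (@coef_vector R G Irr).
Local Notation lam := (fun k : coef_index => l (tag k)).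
Local Notation D := (diagop e lam).

Lemma derivation_dom_coefficient a n : length_function l -> matrix_coefficients G a ->
  derivation_dom D n (@reg R G a).
Proof.
move=> hl; move: a; apply: (@matrix_coefficients_ind R G Irr) => [|z a b da db|al i j].
- have -> : @reg R G 0 = (fun=> 0) by apply/funext => x; exact: reg0.
  exact: derivation_dom0.
- have -> : @reg R G (z *: a + b) = (fun x => z *: reg a x + reg b x).
    by apply/funext => x; exact: reg_comb.
  exact: derivation_dom_comb.
- exact: derivation_dom_irr.
Qed.

Lemma finite_coef_index (N : R) : finite_set [set al | l al <= N] ->
  finite_set [set k : @coef_index R G Irr | l (tag k) <= N].
Proof.
move=> fN; apply: (@sub_finite_set _ _ (\bigcup_(al in [set al | l al <= N])
   range (fun ij : 'I_(irr_dim al) * 'I_(irr_dim al) => basis_index ij.1 ij.2))).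
  by move=> [al [i j]] /= hal; exists al => //; exists (i, j).
by apply: bigcup_finite => // al _; apply: finite_image; exact: finite_finset.
Qed.

End SpectralTriple.

Theorem lemma5p4 (R : realType) (G : discrete_quantum_group R)
    (Irr : irreducibles G) (l : Irr -> R) (hl : proper_length l) :
  regular_spectral_triple (matrix_coefficients G) (@reg R G)
    (length_operator l).
Proof.
rewrite length_operatorE; have [hlen fin _] := hl; have [l0 _ _ _] := hlen.
set D := diagop _ _.
have orth := @coef_vector_orthogonal R G Irr.
have total := @coef_vector_total R G Irr.
have dD a n : matrix_coefficients G a -> derivation_dom D n (@reg R G a).
  exact: derivation_dom_coefficient.
split; first split.
- split; [exact: matrix_coefficients0|exact: matrix_coefficients_comb|
    exact: matrix_coefficientsM|exact: matrix_coefficients_adj].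
- split.
    split=> [a _|z a b _ _ x|a b _ _ x|a _ x y].
    + exact: reg_bounded.
    + exact: reg_comb.
    + exact: regM.
    + exact: reg_adj.
  by move=> a _; apply: reg_faithful.
- exact: diagop_selfadjoint.
- by move=> a /(dD a 1%N) [_ [S cS bS]]; exists S.
- by apply: diagop_compact_resolvent => // N; exact: finite_coef_index.
exists D; first exact: diagop_abs.
move=> a ha; split=> [n|T bT cT n]; first exact: dD.
have [_ [S cS dS]] := dD a n.+1 ha.
by rewrite (commutator_unique bT (derivation_dom_bounded dS) cT cS).
Qed.
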